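(* Let $N \geq 3$ and $R > 0$. Fix $\tilde p > \frac{N+2}{N-2}$ and let $U_{\tilde p}^*$ be the (unique) solution of problem $(\ast)_{\tilde p}$ below. Let $i^*$ be the smallest integer such that $R_{\tilde p}^{i^*} > R$. Then for every integer $i \geq i^*$ there exists $p^i > \frac{N+2}{N-2}$ such that $$R^i_{p^i} = R.$$ In particular, for any $i \geq i^*$ there exists $p^i > \frac{N+2}{N-2}$ such that the problem $$-\Delta v + v = v^{p^i} \text{ in } B_R\setminus\{0\},\quad v>0 \text{ in } B_R\setminus\{0\},\quad \partial_\nu v = 0 \text{ on } \partial B_R,$$ where $B_R\subset\mathbb{R}^N$ is the ball of radius $R$ centred at the origin, admits a singular radial solution $U$ satisfying $$\#\{r \in [0,R] : U(r) = 1\} = i.$$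
   Context: For $N\ge 3$ and $p > \frac{N+2}{N-2}$ set $\theta = \frac{2}{p-1}$ and $A_{p,N} = [\theta(N-2-\theta)]^{\frac{1}{p-1}}$. It is known (Miyamoto) that there is a unique function $U_p^*$ solving $$(\ast)_p\qquad -u'' - \frac{N-1}{r}u' + u = u^p \text{ on } (0,\infty),\qquad \lim_{r\to 0^+} r^\theta u(r) = A_{p,N},\qquad u>0 \text{ on } (0,\infty),$$ and that $U_p^*$ attains the value $1$ infinitely many times. $(R_p^i)_{i\ge1}$ denotes the increasing sequence of positive numbers at which $(U_p^* )'(R_p^i)=0$ (the critical points of $U_p^*$ in $(0,\infty)$). A singular radial solution is understood as $U(x) = U_{p}^*(|x|)$, which blows up at the origin. *)

(* Defs.v *)
From Stdlib Require Import Reals Lra List.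
From Coquelicot Require Import Coquelicot.
Open Scope R_scope.

Definition pS (N : nat) : R := (INR N + 2) / (INR N - 2).

Definition theta (p : R) : R := 2 / (p - 1).

Definition A_pN (p : R) (N : nat) : R :=
  Rpower (theta p * (INR N - 2 - theta p)) (1 / (p - 1)).

Definition solves_star (N : nat) (p : R) (u : R -> R) : Prop :=
  (forall r, 0 < r ->
     ex_derive u r /\ ex_derive (Derive u) r /\ 0 < u r /\
     - Derive (Derive u) r - (INR N - 1) / r * Derive u r + u r
       = Rpower (u r) p) /\
  filterlim (fun r => Rpower r (theta p) * u r) (at_right 0)
            (locally (A_pN p N)).

Definition crit_pt (u : R -> R) (x : R) : Prop := 0 < x /\ Derive u x = 0.

(* nth_crit u i r : r is the i-th critical point of u in (0,oo) (i >= 1),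
   i.e. r = R^i in the increasing enumeration of the critical points. *)
Definition nth_crit (u : R -> R) (i : nat) (r : R) : Prop :=
  (1 <= i)%nat /\ crit_pt u r /\
  exists l : list R, NoDup l /\ length l = (i - 1)%nat /\
    forall x, In x l <-> (crit_pt u x /\ x < r).

(* Main.v *)
Require Import Defs.
From Stdlib Require Import Reals List Lra Lia ClassicalEpsilon FinFun.
From Coquelicot Require Import Coquelicot.
Open Scope R_scope.

(** Put e = 1/(p-1), r = sqrt e * exp t, w = (p-1) ln u and X = - dw/dt, and write
    m = N - 2. The equation becomes
      w' = - X,   X' = e X^2 - m X + exp (2t) (exp w - 1),
    which stays regular as p -> oo (e -> 0), with w + 2t -> ln (2 (m - 2e)) at -oo.
    All estimates below are uniform in 0 < e <= e1 < m/4. The constant state of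
    the autonomous part is stable forward in t, so a solution issued from it at
    -oo is determined by e and depends on it in a Lipschitz way on half-lines
    (-oo, T]. A Pohozaev identity, which is where supercriticality enters, gives
    X' <= exp (2t + w) and excludes monotone decay; with a Sturm comparison and the
    decay of the energy it bounds the i-th zero of X by a constant M_i independent
    of e. Zeros of X are simple, hence the i-th zero tau_i(e) is continuous in e.
    The i-th critical radius is sqrt e * exp (tau_i(e)); it tends to 0 as e -> 0 since
    tau_i(e) <= M_i, and exceeds the given radius at the initial exponent, so the
    intermediate value theorem applies. Between consecutive critical points w is
    strictly monotone and changes sign, which counts the solutions of u = 1. *)

(** The condition [4 * e < m] says exactly that [p] is supercritical, and [m - 4 * e] is the damping
    rate of the linearisation at the singular profile. It is bounded below on [(0, e1]] but
    degenerates at [m / 4], which is why the constants depend on [e1]. As [e -> 0] the equation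
    formally becomes [- Delta w = exp w - 1], but no object at [e = 0] is ever built: bounds uniform
    on [(0, e1]] replace any passage to the limit. The family of solutions is just one given
    solution per exponent, with no regularity in [p]. Continuity comes entirely from the Lipschitz
    estimate, which for equal exponents also contains uniqueness. The main obstacle is bounding the
    first zero of [X]: while [X > 0], the term [e * X^2] could sustain the growth of [X]. Once that
    zero is reached the energy there is purely potential, so the depth of [w] at this point controls
    everything later. *)

(** * Calculus on the line: monotonicity, first zeros, barriers *)

Lemma derive_nonpos_le (f df : R -> R) (a b : R) :
  a <= b ->
  (forall t, a <= t <= b -> is_derive f t (df t)) ->
  (forall t, a <= t <= b -> df t <= 0) -> f b <= f a.
Proof.
  intros ab Hd Hn.
  destruct (MVT_gen f a b df) as [c [Hc He]].
  - rewrite Rmin_left, Rmax_right by lra. intros x Hx. apply Hd; lra.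
  - rewrite Rmin_left, Rmax_right by lra. intros x Hx.
    apply continuity_pt_filterlim, (ex_derive_continuous (V := R_NormedModule)).
    exists (df x). apply Hd; lra.
  - rewrite Rmin_left, Rmax_right in Hc by lra.
    specialize (Hn c Hc). nra.
Qed.

Lemma derive_neg_lt (f df : R -> R) (a b : R) :
  a < b ->
  (forall t, a <= t <= b -> is_derive f t (df t)) ->
  (forall t, a < t < b -> df t < 0) -> f b < f a.
Proof.
  intros ab Hd Hn.
  destruct (MVT_cor2 f df a b ab) as [c [He Hc]].
  - intros c Hc. apply is_derive_Reals, Hd, Hc.
  - specialize (Hn c Hc). nra.
Qed.

Lemma continuous_sign_near (f : R -> R) (a s : R) :
  continuous f a -> 0 < s * f a ->
  exists d, 0 < d /\ forall t, Rabs (t - a) < d -> 0 < s * f t.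
Proof.
  intros Hc Hs.
  assert (Hc' : continuous (fun t => s * f t) a).
  { apply (continuous_scal_r s f a), Hc. }
  destruct (proj1 (filterlim_locally (F := locally a) (fun t => s * f t) (s * f a)) Hc'
              (mkposreal _ Hs)) as [d Hd].
  exists d. split; [apply cond_pos|].
  intros t Ht. specialize (Hd t Ht).
  change (Rabs (s * f t - s * f a) < s * f a) in Hd.
  apply Rabs_def2 in Hd. lra.
Qed.

Lemma first_zero (f : R -> R) (a b : R) :
  a <= b -> (forall t, a <= t <= b -> continuous f t) ->
  0 < f a -> f b <= 0 ->
  exists c, a < c <= b /\ f c = 0 /\ forall t, a <= t < c -> 0 < f t.
Proof.
  intros ab Hc Ha Hb.
  set (S := fun t => a <= t <= b /\ forall u, a <= u <= t -> 0 < f u).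
  assert (Sa : S a).
  { split; [lra|]. intros u Hu. replace u with a by lra. exact Ha. }
  destruct (completeness S) as [c [Hub Hl]].
  - exists b. intros t [Ht _]. lra.
  - exists a. exact Sa.
  - assert (Hac : a <= c) by (apply Hub, Sa).
    assert (Hcb : c <= b) by (apply Hl; intros t [Ht _]; lra).
    assert (Hlt : forall t, a <= t < c -> 0 < f t).
    { intros t Ht.
      destruct (classic (exists u, S u /\ t < u)) as [[u [[Hu1 Hu2] Htu]]|Hn].
      - apply Hu2. lra.
      - exfalso. assert (c <= t); [|lra].
        apply Hl. intros u Hu. destruct (Rle_lt_dec u t) as [Hle|Hlt]; [exact Hle|].
        exfalso. apply Hn. exists u. split; assumption. }
    assert (Hfc : f c = 0).
    { destruct (Rtotal_order (f c) 0) as [H|[H|H]]; [|exact H|].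
      - exfalso. destruct (continuous_sign_near f c (-1)) as [d [Hd1 Hd2]]; [apply Hc; lra|lra|].
        assert (a <> c) by (intro; subst; lra).
        set (t := Rmax a (c - d / 2)).
        assert (a <= t < c) by (unfold t, Rmax; destruct (Rle_dec a (c - d/2)); lra).
        specialize (Hlt t H1).
        assert (0 < -1 * f t); [|lra]. apply Hd2.
        apply Rabs_def1; unfold t, Rmax; destruct (Rle_dec a (c - d/2)); lra.
      - exfalso. destruct (continuous_sign_near f c 1) as [d [Hd1 Hd2]]; [apply Hc; lra|lra|].
        assert (Hne : c <> b) by (intro; subst; lra).
        set (t := Rmin b (c + d / 2)).
        assert (Ht : c < t <= b) by (unfold t, Rmin; destruct (Rle_dec b (c + d/2)); lra).
        assert (Ht' : t <= c + d / 2) by apply Rmin_r.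
        assert (St : S t).
        { split; [lra|]. intros u Hu. destruct (Rlt_le_dec u c) as [Hu'|Hu'].
          - apply Hlt; lra.
          - assert (0 < 1 * f u); [|lra]. apply Hd2. apply Rabs_def1; lra. }
        apply Hub in St. lra. }
    exists c. repeat split; auto.
    destruct Hac as [Hac|Hac]; [exact Hac|]. subst c. lra.
Qed.

Lemma derive_sign_right (f : R -> R) (a d : R) :
  is_derive f a d -> f a = 0 -> 0 < d ->
  exists e, 0 < e /\ (forall t, a < t < a + e -> 0 < f t) /\
    (forall t, a - e < t < a -> f t < 0).
Proof.
  intros Hd Hf Hp. apply is_derive_Reals in Hd.
  destruct (Hd (d / 2)) as [e He]; [lra|].
  exists e. split; [apply cond_pos|].
  assert (K : forall t, t <> a -> Rabs (t - a) < e -> 0 < f t / (t - a)).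
  { intros t Ht1 Ht2. specialize (He (t - a)).
    replace (a + (t - a)) with t in He by ring. rewrite Hf, Rminus_0_r in He.
    specialize (He ltac:(lra) Ht2). apply Rabs_def2 in He. lra. }
  split; intros t Ht.
  - specialize (K t ltac:(lra) ltac:(apply Rabs_def1; lra)).
    replace (f t) with (f t / (t - a) * (t - a)) by (field; lra). nra.
  - specialize (K t ltac:(lra) ltac:(apply Rabs_def1; lra)).
    replace (f t) with (f t / (t - a) * (t - a)) by (field; lra). nra.
Qed.

(** A function that decreases strictly at each of its zeros cannot cross zero upwards. This serves
    to compare solutions with moving curves. *)
Lemma barrier (f df : R -> R) (a b : R) :
  (forall t, a <= t <= b -> is_derive f t (df t)) ->
  f a <= 0 -> (forall t, a <= t <= b -> f t = 0 -> df t < 0) ->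
  forall t, a <= t <= b -> f t <= 0.
Proof.
  intros Hd Ha Hn t Ht. apply Rnot_lt_le. intro Hp.
  assert (Hne : a <> t) by (intro; subst; lra).
  (* Time reversal turns the last zero of [f] before [t] into a first zero. *)
  destruct (first_zero (fun s => f (- s)) (- t) (- a)) as [c [Hc1 [Hc2 Hc3]]].
  - lra.
  - intros s Hs. apply (continuous_comp (fun s => - s) f).
    + apply (continuous_opp (fun s : R => s)), continuous_id.
    + apply (ex_derive_continuous (V := R_NormedModule)).
      exists (df (- s)). apply Hd; lra.
  - rewrite Ropp_involutive. exact Hp.
  - rewrite Ropp_involutive. exact Ha.
  - assert (Hdc : is_derive (fun s => - f s) (- c) (- df (- c))).
    { apply (is_derive_opp f). apply Hd; lra. }
    destruct (derive_sign_right _ _ _ Hdc) as [e [He [He1 _]]].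
    + lra.
    + specialize (Hn (- c) ltac:(lra) Hc2). lra.
    + set (s := Rmin (t) (- c + e / 2)).
      assert (Hs : - c < s <= t) by (unfold s, Rmin; destruct (Rle_dec t (-c + e/2)); lra).
      assert (Hs' : s <= - c + e / 2) by apply Rmin_r.
      specialize (He1 s ltac:(lra)).
      specialize (Hc3 (- s) ltac:(lra)). rewrite Ropp_involutive in Hc3. lra.
Qed.

(** * The singular solution near its singularity *)

(** Value of [exp (2 * t + w)] at the rest state [X = 2] of the autonomous part, from
    [4 * e - 2 * m + L0 = 0]. With [theta = 2 * e], [e * L0 m e] is [theta * (m - theta)], the base
    of the power [A_pN]. *)
Definition L0 (m e : R) : R := 2 * (m - 2 * e).

(** Only [w] is prescribed at [-oo]; the limit [X -> 2] has to be derived. *)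
Definition singular_sol (m e : R) (w X : R -> R) : Prop :=
  (forall t, is_derive w t (- X t)) /\
  (forall t, is_derive X t
     (e * X t ^ 2 - m * X t + exp (2 * t) * (exp (w t) - 1))) /\
  (forall d, 0 < d -> exists T, forall t, t <= T ->
     Rabs (w t + 2 * t - ln (L0 m e)) < d).

(** The functions are abstract, so [auto_derive] leaves their [Derive] behind; it is replaced by the
    right-hand sides of the system. *)
Ltac der_sol Hw HX :=
  match goal with |- is_derive _ ?t _ =>
  match type of (Hw t) with is_derive ?f _ ?l =>
  match type of (HX t) with is_derive ?g _ ?k =>
    let Ew := fresh in let EX := fresh in
    assert (Ew : Derive (fun x => f x) t = l) by exact (is_derive_unique f t l (Hw t));
    assert (EX : Derive (fun x => g x) t = k) by exact (is_derive_unique g t k (HX t));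
    auto_derive;
    [ repeat match goal with
        | |- _ /\ _ => split
        | |- ex_derive (fun x => f x) t => exact (ex_intro _ l (Hw t))
        | |- ex_derive (fun x => g x) t => exact (ex_intro _ k (HX t))
        | |- True => exact I
        end
    | rewrite ?Ew, ?EX ];
    clear Ew EX
  end end end.

Lemma exp_sub_le_sq (h : R) : Rabs h <= / 2 -> exp h - 1 - h <= 2 * h ^ 2.
Proof.
  intros H. apply Rabs_le_between in H.
  assert (H1 : 1 - h <= exp (- h)) by (pose proof (exp_ineq1_le (- h)); lra).
  assert (H2 : exp h * exp (- h) = 1).
  { rewrite <- exp_plus. replace (h + - h) with 0 by ring. apply exp_0. }
  pose proof (exp_pos h).
  assert (H3 : exp h * (1 - h) <= 1) by nra.
  assert (exp h <= 2) by nra. nra.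
Qed.

Lemma L0_pos (m e e1 : R) : 4 * e1 < m -> 0 < e <= e1 -> m <= L0 m e <= 2 * m.
Proof. unfold L0. lra. Qed.

Lemma exp_sol_split (m e w t : R) : 0 < L0 m e ->
  exp (2 * t) * exp w = L0 m e * exp (w + 2 * t - ln (L0 m e)).
Proof.
  intros HL. rewrite <- exp_plus.
  replace (w + 2 * t - ln (L0 m e)) with ((2 * t + w) + - ln (L0 m e)) by ring.
  rewrite (exp_plus (2 * t + w)), exp_Ropp, exp_ln by exact HL. field. lra.
Qed.

(* The energy of the logarithmically scaled equation at its constant solution
   becomes small along some sequence [t -> -oo]: the mean value theorem
   supplies small values of [h' = 2 - X] from [h -> 0]. *)
Lemma start_energy_small (m e e1 : R) (w X : R -> R) (T d : R) :
  4 * e1 < m -> 0 < e <= e1 -> singular_sol m e w X -> 0 < d ->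
  exists t, t < T /\
    (2 - X t) ^ 2 / 2 + exp (2 * t) * exp (w t) - L0 m e
      - L0 m e * (w t + 2 * t - ln (L0 m e)) < d.
Proof.
  intros Hm He [Hw [HX Hlim]] Hd.
  pose proof (L0_pos m e e1 Hm He) as HL.
  (* [h] varies by at most [2 * g] over a unit interval, so some [c] has [(2 - X c)^2 <= 4 * g^2].
     With the quadratic bound on [exp h - 1 - h], the energy at [c] is at most
     [(1 + 2 * m) * g < d]. *)
  set (g := Rmin (/ 2) (d / (3 + 4 * m))).
  assert (Hg : 0 < g).
  { apply Rmin_glb_lt; [lra|]. apply Rdiv_lt_0_compat; lra. }
  assert (Hg1 : g <= / 2) by apply Rmin_l.
  assert (Hg2 : g * (3 + 4 * m) <= d).
  { assert (g <= d / (3 + 4 * m)) by apply Rmin_r.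
    apply Rmult_le_compat_r with (r := 3 + 4 * m) in H; [|lra].
    replace (d / (3 + 4 * m) * (3 + 4 * m)) with d in H by (field; lra). exact H. }
  destruct (Hlim g Hg) as [T' HT].
  set (t0 := Rmin T T' - 2).
  assert (Ht0 : t0 <= T - 2 /\ t0 <= T' - 2).
  { unfold t0. pose proof (Rmin_l T T'). pose proof (Rmin_r T T'). lra. }
  destruct (MVT_cor2 (fun t => w t + 2 * t - ln (L0 m e)) (fun t => 2 - X t) t0 (t0 + 1))
    as [c [Hc1 Hc2]].
  - lra.
  - intros c Hc. apply is_derive_Reals. der_sol Hw HX. ring.
  - exists c. split; [lra|].
    rewrite (exp_sol_split m e) by lra.
    pose proof (HT (t0 + 1) ltac:(lra)) as K1. pose proof (HT t0 ltac:(lra)) as K2.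
    pose proof (HT c ltac:(lra)) as K3.
    cbv beta in Hc1.
    apply Rabs_def2 in K1. apply Rabs_def2 in K2.
    set (h := w c + 2 * c - ln (L0 m e)) in *.
    assert (Kh := exp_sub_le_sq h ltac:(lra)).
    apply Rabs_def2 in K3.
    assert (Hy : (2 - X c) ^ 2 <= (2 * g) ^ 2).
    { assert (- (2 * g) <= 2 - X c <= 2 * g) by lra. nra. }
    assert (h ^ 2 <= g ^ 2) by nra.
    assert (g ^ 2 <= g / 2) by nra.
    assert (L0 m e * (exp h - 1 - h) <= 2 * m * (2 * h ^ 2)).
    { apply Rmult_le_compat; try lra. pose proof (exp_ineq1_le h). lra. }
    nra.
Qed.

(** With [h = w + 2 t - ln L0] and [y = h' = 2 - X], the energy [y^2 / 2 + L0 (exp h - 1 - h)] has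
    derivative [- (m - 4 e) y^2 - e y^3 + y exp (2 t)]. It starts arbitrarily small; while it is
    small the damping dominates the cubic term, and only the forcing contributes, at order
    [exp (4 t)]. *)
Lemma start_bound (m e1 : R) : 0 < e1 -> 4 * e1 < m ->
  exists T0 C, 0 < C /\ forall e w X, 0 < e <= e1 -> singular_sol m e w X ->
    forall t, t <= T0 ->
      Rabs (2 - X t) <= C * exp (2 * t) /\
      Rabs (w t + 2 * t - ln (L0 m e)) <= C * exp (2 * t).
Proof.
  intros He1 Hm. set (a := m - 4 * e1). assert (Ha : 0 < a) by (unfold a; lra).
  (* Energy at most [rho] gives [|y| <= a / (2 * e1)], so the cubic term uses up at most half of the
     damping. Up to [T0] the barrier [exp (4 t) / (2 a)] stays below [rho / 2]. *)
  set (rho := (a / e1) ^ 2 / 8).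
  assert (Hae : 0 < a / e1) by (apply Rdiv_lt_0_compat; lra).
  assert (Hrho : 0 < rho) by (unfold rho; nra).
  set (T0 := ln (a * rho) / 4).
  exists T0, (/ sqrt a).
  pose proof (sqrt_lt_R0 a Ha) as Hsq.
  split; [apply Rinv_0_lt_compat, Hsq|].
  intros e w X He Hsol.
  pose proof (L0_pos m e e1 Hm He) as HL.
  assert (HT0 : forall t, t <= T0 -> exp (4 * t) <= a * rho).
  { intros t Ht. rewrite <- (exp_ln (a * rho)) by nra.
    destruct Ht as [Ht|Ht]; [left; apply exp_increasing; unfold T0 in Ht; lra|].
    right. f_equal. rewrite Ht. unfold T0. field. }
  set (E := fun t => (2 - X t) ^ 2 / 2 + exp (2 * t) * exp (w t) - L0 m e
      - L0 m e * (w t + 2 * t - ln (L0 m e))).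
  assert (HEy : forall t, (2 - X t) ^ 2 / 2 <= E t).
  { intros t. unfold E. rewrite (exp_sol_split m e) by lra.
    pose proof (exp_ineq1_le (w t + 2 * t - ln (L0 m e))). nra. }
  assert (HE : forall t, t <= T0 -> E t <= exp (4 * t) / (2 * a)).
  { intros t Ht. apply le_epsilon. intros eps Heps.
    set (eta := Rmin eps (rho / 4)).
    assert (Heta : 0 < eta) by (apply Rmin_glb_lt; lra).
    assert (Heta1 : eta <= eps) by apply Rmin_l.
    assert (Heta2 : eta <= rho / 4) by apply Rmin_r.
    destruct (start_energy_small m e e1 w X t eta Hm He Hsol Heta) as [s [Hs1 Hs2]].
    fold (E s) in Hs2. destruct Hsol as [Hw [HX _]].
    set (dE := fun t => - (m - 4 * e) * (2 - X t) ^ 2 - e * (2 - X t) ^ 3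
                        + (2 - X t) * exp (2 * t)).
    assert (HdE : forall t, is_derive E t (dE t)).
    { intros u. unfold E, dE. der_sol Hw HX. unfold L0. field. }
    enough (E t - (eta + exp (4 * t) / (2 * a)) <= 0) by lra.
    (* On contact, completing the square bounds the slope of [E] by [exp (4 t) / (2 a)], a quarter
       of the slope of the barrier. *)
    apply (barrier (fun t => E t - (eta + exp (4 * t) / (2 * a)))
             (fun t => dE t - 2 * exp (4 * t) / a) s t).
    - intros u Hu. apply (is_derive_minus E); [apply HdE|].
      auto_derive; [lra|field; lra].
    - pose proof (exp_pos (4 * s)).
      assert (0 < exp (4 * s) / (2 * a)) by (apply Rdiv_lt_0_compat; lra). lra.
    - intros u Hu Hz. pose proof (HEy u) as Hy.
      assert (H4 : exp (4 * u) / (2 * a) <= rho / 2).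
      { specialize (HT0 u ltac:(lra)). apply Rmult_le_reg_r with (2 * a); [lra|].
        replace (exp (4 * u) / (2 * a) * (2 * a)) with (exp (4 * u)) by (field; lra). lra. }
      set (y := 2 - X u) in *.
      assert (Hy2 : y ^ 2 <= (a / e1 / 2) ^ 2) by (unfold rho in *; nra).
      assert (Hy3 : Rabs y <= a / e1 / 2).
      { apply Rabs_le. nra. }
      assert (Hy4 : - (a / 2) <= e * y).
      { apply Rabs_le_between in Hy3.
        assert (e * (a / e1 / 2) <= e1 * (a / e1 / 2)) by (apply Rmult_le_compat_r; lra).
        replace (e1 * (a / e1 / 2)) with (a / 2) in H by (field; lra). nra. }
      assert (HdE1 : dE u <= - (a / 2) * y ^ 2 + y * exp (2 * u)).
      { unfold dE. fold y. replace (e * y ^ 3) with (e * y * y ^ 2) by ring.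
        assert (a <= m - 4 * e) by (unfold a; lra).
        assert (0 <= y ^ 2) by nra. nra. }
      replace (4 * u) with (2 * u + 2 * u) by ring. rewrite exp_plus.
      pose proof (exp_pos (2 * u)). set (q := exp (2 * u)) in *.
      assert (0 < q * q / a) by (apply Rdiv_lt_0_compat; nra).
      replace (2 * (q * q) / a) with (2 * (q * q / a)) by (field; lra).
      assert (0 <= a / 2 * (y - q / a) ^ 2) by (apply Rmult_le_pos; [lra|apply pow2_ge_0]).
      replace (a / 2 * (y - q / a) ^ 2) with (a / 2 * y ^ 2 - y * q + q * q / a / 2) in H1
        by (field; lra).
      lra.
    - lra. }
  assert (Hy : forall t, t <= T0 -> Rabs (2 - X t) <= / sqrt a * exp (2 * t)).
  { intros t Ht. specialize (HE t Ht). pose proof (HEy t).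
    pose proof (exp_pos (2 * t)).
    assert (0 < / sqrt a) by (apply Rinv_0_lt_compat, Hsq).
    assert (Hq : (/ sqrt a * exp (2 * t)) ^ 2 = exp (4 * t) / a).
    { replace (4 * t) with (2 * t + 2 * t) by ring. rewrite exp_plus.
      rewrite <- (sqrt_sqrt a) at 2 by lra. field. lra. }
    apply Rabs_le.
    assert (0 < / sqrt a * exp (2 * t)) by nra.
    assert ((2 - X t) ^ 2 <= (/ sqrt a * exp (2 * t)) ^ 2).
    { rewrite Hq. replace (exp (4 * t) / a) with (2 * (exp (4 * t) / (2 * a))) by (field; lra). lra. }
    nra. }
  intros t Ht. split; [apply Hy, Ht|].
  destruct Hsol as [Hw [HX Hlim]].
  assert (0 < / sqrt a) by (apply Rinv_0_lt_compat, Hsq). set (C := / sqrt a) in *.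
  pose proof (exp_pos (2 * t)) as Hp.
  assert (HC : 0 < C * exp (2 * t)) by nra.
  (* Integrating [|2 - X| <= C exp (2 s)] from [-oo]; the arbitrary [d] stands for the vanishing
     boundary value there. *)
  assert (Hhalf : forall d, 0 < d -> Rabs (w t + 2 * t - ln (L0 m e)) <= d + C / 2 * exp (2 * t)).
  { intros d Hd. destruct (Hlim d Hd) as [T HT].
    set (s := Rmin T t). assert (Hs : s <= T) by apply Rmin_l. assert (Hst : s <= t) by apply Rmin_r.
    specialize (HT s Hs). apply Rabs_def2 in HT.
    pose proof (exp_pos (2 * s)).
    assert (0 < C / 2 * exp (2 * s)) by nra.
    apply Rabs_le. split.
    - assert (- (w t + 2 * t - ln (L0 m e) + C / 2 * exp (2 * t)) <=
              - (w s + 2 * s - ln (L0 m e) + C / 2 * exp (2 * s))).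
      { apply (derive_nonpos_le (fun t => - (w t + 2 * t - ln (L0 m e) + C / 2 * exp (2 * t)))
          (fun t => - (2 - X t + C * exp (2 * t)))); [exact Hst| |].
        - intros u _. der_sol Hw HX. field.
        - intros u Hu. specialize (Hy u ltac:(lra)). apply Rabs_le_between in Hy. lra. }
      lra.
    - assert ((w t + 2 * t - ln (L0 m e) - C / 2 * exp (2 * t)) <=
              (w s + 2 * s - ln (L0 m e) - C / 2 * exp (2 * s))).
      { apply (derive_nonpos_le (fun t => (w t + 2 * t - ln (L0 m e) - C / 2 * exp (2 * t)))
          (fun t => (2 - X t - C * exp (2 * t)))); [exact Hst| |].
        - intros u _. der_sol Hw HX. field.
        - intros u Hu. specialize (Hy u ltac:(lra)). apply Rabs_le_between in Hy. lra. }
      lra. }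
  specialize (Hhalf (C / 2 * exp (2 * t)) ltac:(nra)). lra.
Qed.

(** * Pohozaev identity and Sturm oscillation *)

Lemma exp_le (x y : R) : x <= y -> exp x <= exp y.
Proof. intros [H|H]; [left; apply exp_increasing, H|right; congruence]. Qed.

Lemma exp_small (c d : R) : 0 < c -> 0 < d -> exists T, forall s, s <= T -> exp (c * s) <= d.
Proof.
  intros Hc Hd. exists (ln d / c). intros s Hs.
  rewrite <- (exp_ln d) by exact Hd. apply exp_le.
  replace (ln d) with (c * (ln d / c)) by (field; lra).
  apply Rmult_le_compat_l; lra.
Qed.

Lemma exp_large (c d : R) : 0 < c -> exists T, forall s, T <= s -> d <= exp (c * s).
Proof.
  intros Hc. exists (d / c). intros s Hs.
  pose proof (exp_ineq1_le (c * s)).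
  assert (c * (d / c) <= c * s) by (apply Rmult_le_compat_l; lra).
  replace (c * (d / c)) with d in H0 by (field; lra). lra.
Qed.

Lemma start_unit (m e1 : R) : 0 < e1 -> 4 * e1 < m ->
  exists T0, forall e w X, 0 < e <= e1 -> singular_sol m e w X ->
    forall t, t <= T0 ->
      Rabs (2 - X t) <= 1 /\ Rabs (w t + 2 * t - ln (L0 m e)) <= 1.
Proof.
  intros He1 Hm. destruct (start_bound m e1 He1 Hm) as [T [C [HC H]]].
  destruct (exp_small 2 (/ C)) as [T' HT']; [lra|apply Rinv_0_lt_compat, HC|].
  exists (Rmin T T'). intros e w X He Hs t Ht.
  pose proof (Rmin_l T T'). pose proof (Rmin_r T T').
  destruct (H e w X He Hs t ltac:(lra)) as [K1 K2].
  specialize (HT' t ltac:(lra)).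
  assert (C * exp (2 * t) <= 1).
  { replace 1 with (C * / C) by (field; lra). apply Rmult_le_compat_l; lra. }
  lra.
Qed.

(* Pohozaev: [P] is the scaled functional
   [r^N (u'^2 / 2 + u^(p+1) / (p+1) - u^2 / 2) + (N-2)/2 r^(N-1) u u'],
   which vanishes at the singularity because [p] is supercritical. *)
Lemma pohozaev (m e : R) (w X : R -> R) :
  4 * e < m -> 0 < e -> singular_sol m e w X ->
  forall t, e * X t ^ 2 - m * X t <= exp (2 * t).
Proof.
  intros Hm He Hsol t. pose proof Hsol as [Hw [HX _]].
  pose proof (L0_pos m e e Hm ltac:(lra)) as HL.
  (* The value for which the terms in [X * exp (2 t + w)] cancel in the derivative of [P]. *)
  set (b := 2 * e / (1 + 2 * e)).
  assert (Hb : 0 < b < 1).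
  { unfold b. split; [apply Rdiv_lt_0_compat; lra|].
    apply Rmult_lt_reg_r with (1 + 2 * e); [lra|].
    replace (2 * e / (1 + 2 * e) * (1 + 2 * e)) with (2 * e) by (field; lra). lra. }
  set (P := fun t => exp (m * t) * exp (2 * e * w t) *
    (e * X t ^ 2 - m * X t - exp (2 * t) + b * (exp (2 * t) * exp (w t)))).
  assert (HP : forall s, s <= t -> P t <= P s).
  { intros s Hs. apply (derive_nonpos_le P
      (fun t => - (exp (m * t) * exp (2 * e * w t) *
         ((m - 4 * e) / (1 + 2 * e) * (exp (2 * t) * exp (w t)) + 2 * exp (2 * t)))) s t Hs).
    - intros u _. unfold P. der_sol Hw HX. unfold b. field. lra.
    - intros u _. pose proof (exp_pos (m * u)). pose proof (exp_pos (2 * e * w u)).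
      pose proof (exp_pos (2 * u)). pose proof (exp_pos (w u)).
      assert (0 < (m - 4 * e) / (1 + 2 * e)) by (apply Rdiv_lt_0_compat; lra).
      enough (0 <= exp (m * u) * exp (2 * e * w u) *
         ((m - 4 * e) / (1 + 2 * e) * (exp (2 * u) * exp (w u)) + 2 * exp (2 * u))) by lra.
      apply Rmult_le_pos; [apply Rmult_le_pos; lra|].
      apply Rplus_le_le_0_compat; [|lra].
      apply Rmult_le_pos; [lra|apply Rmult_le_pos; lra]. }
  destruct (start_unit m e He Hm) as [T0 HT0].
  set (K := 9 * e + L0 m e * exp 1).
  set (M := exp (2 * e * (1 + ln (L0 m e)))).
  assert (HK : 0 < K) by (unfold K; pose proof (exp_pos 1); nra).
  assert (HM : 0 < M) by apply exp_pos.
  assert (HP0 : forall s, s <= T0 -> P s <= exp ((m - 4 * e) * s) * (M * K)).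
  { intros s Hs. destruct (HT0 e w X ltac:(lra) Hsol s Hs) as [K1 K2].
    apply Rabs_le_between in K1. apply Rabs_le_between in K2.
    pose proof (exp_sol_split m e (w s) s ltac:(lra)) as Hsp.
    unfold P. rewrite Hsp.
    set (h := w s + 2 * s - ln (L0 m e)) in *.
    replace (exp (m * s) * exp (2 * e * w s)) with
       (exp ((m - 4 * e) * s) * exp (2 * e * (h + ln (L0 m e)))).
    2: { rewrite <- !exp_plus. f_equal. unfold h. ring. }
    assert (exp h <= exp 1) by (apply exp_le; lra).
    assert (exp (2 * e * (h + ln (L0 m e))) <= M) by (apply exp_le; nra).
    assert (HQ : e * X s ^ 2 - m * X s - exp (2 * s) + b * (L0 m e * exp h) <= K).
    { pose proof (exp_pos h). pose proof (exp_pos (2 * s)).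
      assert (b * (L0 m e * exp h) <= 1 * (L0 m e * exp 1)).
      { apply Rmult_le_compat; try lra; [apply Rmult_le_pos; lra|].
        apply Rmult_le_compat_l; lra. }
      assert (X s ^ 2 <= 9) by nra.
      assert (0 <= m * X s) by (apply Rmult_le_pos; lra).
      unfold K. nra. }
    pose proof (exp_pos ((m - 4 * e) * s)).
    pose proof (exp_pos (2 * e * (h + ln (L0 m e)))).
    set (Q := e * X s ^ 2 - m * X s - exp (2 * s) + b * (L0 m e * exp h)) in *.
    apply Rle_trans with (exp ((m - 4 * e) * s) * exp (2 * e * (h + ln (L0 m e))) * K).
    - apply Rmult_le_compat_l; [apply Rmult_le_pos; lra|exact HQ].
    - rewrite (Rmult_assoc (exp _) (exp _) K). apply Rmult_le_compat_l; [lra|].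
      apply Rmult_le_compat_r; lra. }
  assert (HPt : P t <= 0).
  { apply le_epsilon. intros eps Heps.
    destruct (exp_small (m - 4 * e) (eps / (M * K))) as [T1 HT1].
    - lra.
    - apply Rdiv_lt_0_compat; nra.
    - set (s := Rmin t (Rmin T0 T1)).
      pose proof (Rmin_l t (Rmin T0 T1)). pose proof (Rmin_r t (Rmin T0 T1)).
      pose proof (Rmin_l T0 T1). pose proof (Rmin_r T0 T1). fold s in H, H0.
      specialize (HP s ltac:(lra)). specialize (HP0 s ltac:(lra)).
      specialize (HT1 s ltac:(lra)).
      assert (exp ((m - 4 * e) * s) * (M * K) <= eps / (M * K) * (M * K)).
      { apply Rmult_le_compat_r; [nra|lra]. }
      replace (eps / (M * K) * (M * K)) with eps in H3 by (field; lra). lra. }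
  unfold P in HPt.
  pose proof (exp_pos (m * t)). pose proof (exp_pos (2 * e * w t)).
  pose proof (exp_pos (2 * t)). pose proof (exp_pos (w t)).
  assert (0 < b * (exp (2 * t) * exp (w t))) by (apply Rmult_lt_0_compat; nra).
  apply Rnot_lt_le. intro Hc.
  assert (0 < exp (m * t) * exp (2 * e * w t) *
    (e * X t ^ 2 - m * X t - exp (2 * t) + b * (exp (2 * t) * exp (w t)))).
  { apply Rmult_lt_0_compat; [nra|lra]. }
  lra.
Qed.

(** [H] is the weighted Wronskian of [z] with [exp (- m t / 2) sin (t - c)], a solution of
    [y'' + m y' + (1 + m^2 / 4) y = 0]. The hypotheses make it nonincreasing, yet it is negative at
    [c] and positive at [c + PI]. *)
Lemma sturm_window (m c : R) (z z1 f : R -> R) :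
  (forall t, c <= t <= c + PI -> is_derive z t (z1 t)) ->
  (forall t, c <= t <= c + PI -> is_derive z1 t (- m * z1 t - f t)) ->
  (forall t, c <= t <= c + PI -> 0 < z t /\ (1 + m ^ 2 / 4) * z t <= f t) -> False.
Proof.
  intros Hz Hz1 Hp. pose proof PI_RGT_0 as Hpi.
  set (H := fun t => exp (m / 2 * t) *
     ((z1 t + m / 2 * z t) * sin (t - c) - z t * cos (t - c))).
  assert (HH : H (c + PI) <= H c).
  { apply (derive_nonpos_le H (fun t => exp (m / 2 * t) * sin (t - c) *
             ((1 + m ^ 2 / 4) * z t - f t))).
    - lra.
    - intros t Ht. unfold H.
      assert (Ew : Derive (fun x => z x) t = z1 t) by (apply is_derive_unique, Hz, Ht).
      assert (EX : Derive (fun x => z1 x) t = - m * z1 t - f t)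
        by (apply is_derive_unique, Hz1, Ht).
      auto_derive.
      + repeat match goal with
        | |- _ /\ _ => split
        | |- ex_derive (fun x => z x) t => exact (ex_intro _ _ (Hz t Ht))
        | |- ex_derive (fun x => z1 x) t => exact (ex_intro _ _ (Hz1 t Ht))
        | |- True => exact I
        end.
      + rewrite Ew, EX. replace (t + - c) with (t - c) by ring. field.
    - intros t Ht. specialize (Hp t Ht).
      assert (0 <= sin (t - c)) by (apply sin_ge_0; lra).
      pose proof (exp_pos (m / 2 * t)).
      assert (0 <= exp (m / 2 * t) * sin (t - c)) by (apply Rmult_le_pos; lra).
      nra. }
  unfold H in HH. replace (c + PI - c) with PI in HH by ring.
  replace (c - c) with 0 in HH by ring.
  rewrite sin_PI, cos_PI, sin_0, cos_0 in HH.
  pose proof (proj1 (Hp c ltac:(lra))). pose proof (proj1 (Hp (c + PI) ltac:(lra))).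
  pose proof (exp_pos (m / 2 * c)). pose proof (exp_pos (m / 2 * (c + PI))).
  assert (0 < exp (m / 2 * c) * z c) by nra.
  assert (0 < exp (m / 2 * (c + PI)) * z (c + PI)) by nra.
  nra.
Qed.

Lemma sol_cont_w (m e : R) (w X : R -> R) (t : R) : singular_sol m e w X -> continuous w t.
Proof.
  intros [Hw _]. apply (ex_derive_continuous (V := R_NormedModule)). eexists; apply Hw.
Qed.

Lemma sol_cont_X (m e : R) (w X : R -> R) (t : R) : singular_sol m e w X -> continuous X t.
Proof.
  intros [_ [HX _]]. apply (ex_derive_continuous (V := R_NormedModule)). eexists; apply HX.
Qed.

Lemma first_zero_signed (f : R -> R) (a b s : R) :
  s = 1 \/ s = -1 ->
  a <= b -> (forall t, a <= t <= b -> continuous f t) ->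
  0 < s * f a -> s * f b <= 0 ->
  exists c, a < c <= b /\ f c = 0 /\ forall t, a <= t < c -> 0 < s * f t.
Proof.
  intros Hs ab Hc Ha Hb.
  destruct (first_zero (fun t => s * f t) a b ab) as [c [H1 [H2 H3]]]; auto.
  - intros t Ht. apply (continuous_scal_r s f t), Hc, Ht.
  - exists c. repeat split; try lra; [|exact H3].
    destruct Hs; subst s; lra.
Qed.

Lemma no_zero_sign (f : R -> R) (a b : R) :
  (forall t, a <= t <= b -> continuous f t) ->
  (forall t, a <= t <= b -> f t <> 0) ->
  exists s, (s = 1 \/ s = -1) /\ forall t, a <= t <= b -> 0 < s * f t.
Proof.
  intros Hc Hn. destruct (Rlt_le_dec b a) as [Hba|Hab].
  { exists 1. split; [left; reflexivity|]. intros; lra. }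
  assert (K : exists s, (s = 1 \/ s = -1) /\ 0 < s * f a).
  { destruct (Rtotal_order (f a) 0) as [H|[H|H]].
    - exists (-1). split; [right; reflexivity|lra].
    - exfalso. apply (Hn a); lra.
    - exists 1. split; [left; reflexivity|lra]. }
  destruct K as [s [Hs Ha]]. exists s. split; [exact Hs|].
  intros t Ht. apply Rnot_le_lt. intro Hle.
  destruct (first_zero_signed f a t s Hs) as [c [H1 [H2 _]]]; try lra.
  - intros u Hu. apply Hc; lra.
  - apply (Hn c); lra.
Qed.

(** The substitution [z = (exp (e * w) - 1) / e], that is [(u - 1) / e], absorbs the quadratic term
    [e * X^2] and leaves [z'' + m z' + f = 0]. For [w < 0] the ratio [f / z] is bounded below only
    through [exp (2 t + (1 + e) w)], hence the bound [- k] on [w] and the factor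
    [exp (- ((1 + e1) * k))]. *)
Lemma w_zero_window (m e1 k c e : R) (w X : R -> R) :
  0 < e <= e1 -> 0 <= k -> singular_sol m e w X ->
  (forall t, c <= t <= c + PI -> - k <= w t) ->
  1 + m ^ 2 / 4 <= exp (2 * c) * exp (- ((1 + e1) * k)) ->
  exists t, c <= t <= c + PI /\ w t = 0.
Proof.
  intros He Hk Hsol Hlow Hc. pose proof Hsol as [Hw [HX _]].
  apply NNPP. intro Hno.
  destruct (no_zero_sign w c (c + PI)) as [s [Hs Hpos]].
  - intros t _. apply (sol_cont_w m e w X t Hsol).
  - intros t Ht H0. apply Hno. exists t. split; assumption.
  - apply (sturm_window m c (fun t => s * ((exp (e * w t) - 1) / e))
             (fun t => s * (- exp (e * w t) * X t))
             (fun t => s * (exp (2 * t) * (exp (e * w t) * (exp (w t) - 1))))).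
    + intros t _. der_sol Hw HX. field. lra.
    + intros t _. der_sol Hw HX. ring.
    + intros t Ht. specialize (Hpos t Ht). specialize (Hlow t Ht).
      set (V := exp (e * w t)). set (q := exp (- ((1 + e1) * k))) in *.
      assert (HV : 0 < V) by apply exp_pos.
      assert (Hq : 0 < q <= 1).
      { split; [apply exp_pos|]. unfold q. apply Rle_trans with (exp 0); [apply exp_le; nra|rewrite exp_0; lra]. }
      assert (Hct : exp (2 * c) <= exp (2 * t)) by (apply exp_le; lra).
      assert (Hm2 : 1 + m ^ 2 / 4 <= exp (2 * t) * q) by nra.
      assert (HV1 : 1 + e * w t <= V) by apply exp_ineq1_le.
      assert (HV2 : V * (1 - e * w t) <= 1).
      { pose proof (exp_ineq1_le (- (e * w t))) as Hi.
        assert (Hi' : V * exp (- (e * w t)) = 1).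
        { unfold V. rewrite <- exp_plus. replace (e * w t + - (e * w t)) with 0 by ring. apply exp_0. }
        nra. }
      pose proof (exp_ineq1_le (w t)) as Hw1.
      assert (0 < (exp (2 * t))) by apply exp_pos.
      assert (Hzz : (V - 1) / e * e = V - 1) by (field; lra).
      set (z := (V - 1) / e) in *.
      assert (Hmp : 0 < 1 + m ^ 2 / 4) by (pose proof (pow2_ge_0 m); lra).
      assert (key : 0 < s * z /\ q * (s * z) <= s * (V * (exp (w t) - 1))).
      { destruct Hs; subst s.
        - assert (0 < w t) by lra.
          assert (0 < z).
          { apply Rmult_lt_reg_r with e; [lra|]. rewrite Hzz. nra. }
          assert (z <= V * w t).
          { apply Rmult_le_reg_r with e; [lra|]. rewrite Hzz. nra. }
          split; [lra|]. assert (V * w t <= V * (exp (w t) - 1)) by (apply Rmult_le_compat_l; lra).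
          nra.
        - assert (w t < 0) by lra.
          assert (z < 0).
          { apply Rmult_lt_reg_r with e; [lra|]. rewrite Hzz.
            assert (V * (1 - e * w t) <= 1) by exact HV2.
            assert (e * w t < 0) by nra. assert (V * (e * w t) < 0) by nra. lra. }
          assert (- z <= - w t).
          { apply Rmult_le_reg_r with e; [lra|].
            replace (- z * e) with (- (z * e)) by ring. rewrite Hzz. lra. }
          split; [lra|].
          assert (Hqv : q <= V * exp (w t)).
          { unfold q, V. rewrite <- exp_plus. apply exp_le.
            assert (e * - w t <= e1 * k) by (apply Rmult_le_compat; lra). lra. }
          assert (Hew : 1 - exp (w t) >= - w t * exp (w t)).
          { pose proof (exp_ineq1_le (- w t)) as Hi.
            assert (Hi' : exp (w t) * exp (- w t) = 1).
            { rewrite <- exp_plus. replace (w t + - w t) with 0 by ring. apply exp_0. }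
            pose proof (exp_pos (w t)). nra. }
          assert (q * - z <= V * exp (w t) * (- w t)) by (apply Rmult_le_compat; lra).
          nra. }
      destruct key as [key1 key2]. split; [exact key1|].
      apply Rle_trans with (exp (2 * t) * q * (s * z)).
      * apply Rmult_le_compat_r; lra.
      * replace (s * (exp (2 * t) * (V * (exp (w t) - 1)))) with
          (exp (2 * t) * (s * (V * (exp (w t) - 1)))) by ring.
        rewrite Rmult_assoc. apply Rmult_le_compat_l; lra.
Qed.

(** * Uniform bound on the first critical point *)

Lemma positive_phase (m e : R) (w X : R -> R) (a t W : R) :
  4 * e < m -> 0 < e -> singular_sol m e w X -> a <= t ->
  (forall u, a <= u <= t -> 0 <= X u) -> X a <= 3 -> w a <= W ->
  w t <= w a /\ X t <= 3 + exp (2 * t + W).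
Proof.
  intros Hm He Hsol Hat Hpos Ha HW. pose proof Hsol as [Hw [HX _]].
  assert (Hdec : forall u, a <= u <= t -> w u <= w a).
  { intros u Hu. apply (derive_nonpos_le w (fun t => - X t)); [lra| |].
    - intros v _. apply Hw.
    - intros v Hv. specialize (Hpos v ltac:(lra)). lra. }
  split; [apply Hdec; lra|].
  assert (K : X t - exp W * exp (2 * t) / 2 <= X a - exp W * exp (2 * a) / 2).
  { apply (derive_nonpos_le (fun t => X t - exp W * exp (2 * t) / 2)
      (fun t => e * X t ^ 2 - m * X t + exp (2 * t) * (exp (w t) - 1) - exp W * exp (2 * t)));
      [lra| |].
    - intros u _. der_sol Hw HX. field.
    - intros u Hu. pose proof (pohozaev m e w X Hm He Hsol u).
      specialize (Hdec u ltac:(lra)). pose proof (exp_pos (2 * u)).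
      assert (exp (w u) <= exp W) by (apply exp_le; lra). nra. }
  pose proof (exp_pos W). pose proof (exp_pos (2 * a)). pose proof (exp_pos (2 * t)).
  rewrite exp_plus.
  assert (0 < exp W * exp (2 * a)) by (apply Rmult_lt_0_compat; lra).
  assert (0 < exp W * exp (2 * t)) by (apply Rmult_lt_0_compat; lra). nra.
Qed.

(** If [X] stayed positive on [[T0, T1]], [w] would decrease, and two Sturm windows force it below
    [-1]; from then on [X' <= e X^2 - exp (2 t) / 2]. Below the curve [kp * exp t] the quadratic
    term is harmless and [X] is driven to zero. The point is that [X] gets below this curve at a
    time bounded independently of [e]. *)
Lemma first_crit_uniform (m e1 : R) : 0 < e1 -> 4 * e1 < m ->
  exists T0 T1 k B, T0 < T1 /\ 0 <= k /\ 0 <= B /\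
  forall e w X, 0 < e <= e1 -> singular_sol m e w X ->
   (forall t, t <= T0 ->
      Rabs (2 - X t) <= 1 /\ Rabs (w t + 2 * t - ln (L0 m e)) <= 1) /\
   exists t1, T0 < t1 <= T1 /\ X t1 = 0 /\ (forall t, t < t1 -> 0 < X t) /\
     forall t, T0 <= t <= t1 -> X t <= B /\ - k <= w t <= k.
Proof.
  intros He1 Hm. destruct (start_unit m e1 He1 Hm) as [T0 HT0].
  pose proof PI_RGT_0 as Hpi. pose proof PI_4 as Hpi4.
  set (W := 1 + ln (2 * m) - 2 * T0).
  set (q := exp (- ((1 + e1) * 1))). assert (Hq : 0 < q) by apply exp_pos.
  destruct (exp_large 2 ((1 + m ^ 2 / 4) / q)) as [c1 Hc1]; [lra|].
  set (ca := Rmax T0 c1).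
  assert (Hca : T0 <= ca /\ c1 <= ca) by (split; [apply Rmax_l|apply Rmax_r]).
  (* Room for the windows [[ca, ca + PI]] and [[ca + 5, ca + 5 + PI]], disjoint because
     [PI <= 4]. *)
  set (Tb := ca + 9).
  (* Chosen so that [e * X^2 <= exp (2 t) / 4] whenever [0 < X <= kp * exp t]. *)
  set (kp := Rmin 1 (/ (4 * e1))).
  assert (Hkp : 0 < kp) by (apply Rmin_glb_lt; [lra|apply Rinv_0_lt_compat; lra]).
  assert (Hkp1 : kp ^ 2 * e1 <= / 4).
  { assert (kp <= 1) by apply Rmin_l. assert (kp <= / (4 * e1)) by apply Rmin_r.
    assert (kp * e1 <= / (4 * e1) * e1) by (apply Rmult_le_compat_r; lra).
    replace (/ (4 * e1) * e1) with (/ 4) in H1 by (field; lra). nra. }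
  (* Bounds at [Tb] the Lyapunov function used below; by the time [Td], [kp * exp t] has outgrown
     it. *)
  set (K := 3 + exp (2 * Tb + W) + exp Tb / kp + / kp ^ 2).
  destruct (exp_large 1 (K / kp)) as [Td0 HTd0]; [lra|].
  set (Td := Rmax (Tb + 1) Td0).
  assert (HTd : Tb + 1 <= Td) by apply Rmax_l.
  assert (HTdK : K <= kp * exp Td).
  { assert (Td0 <= Td) by apply Rmax_r. specialize (HTd0 Td H).
    rewrite Rmult_1_l in HTd0.
    replace K with (kp * (K / kp)) by (field; lra). apply Rmult_le_compat_l; lra. }
  (* Late enough for a drift of [- exp (2 t) / 4], acting from [Td] at the latest, to consume the
     height [kp * exp Td]. *)
  destruct (exp_large 2 (exp (2 * Td) + 8 * kp * exp Td + 1)) as [T10 HT10]; [lra|].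
  set (T1 := Rmax (Td + 1) T10).
  assert (HT1 : Td + 1 <= T1) by apply Rmax_l.
  specialize (HT10 T1 (Rmax_r _ _)).
  set (B := 3 + exp (2 * T1 + W)).
  assert (HB : 0 < B) by (unfold B; pose proof (exp_pos (2 * T1 + W)); lra).
  exists T0, T1, (Rabs W + Rabs (-1 + ln m - 2 * T0) + (T1 - T0) * B), B.
  split; [unfold Tb in *; lra|].
  split.
  { pose proof (Rabs_pos W). pose proof (Rabs_pos (-1 + ln m - 2 * T0)).
    assert (0 <= (T1 - T0) * B) by (apply Rmult_le_pos; unfold Tb in *; lra). lra. }
  split; [lra|].
  intros e w X He Hsol. split; [apply (HT0 e w X He Hsol)|].
  pose proof Hsol as [Hw [HX _]]. pose proof (L0_pos m e e1 Hm He) as HL.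
  destruct (HT0 e w X He Hsol T0 ltac:(lra)) as [I1 I2].
  apply Rabs_le_between in I1. apply Rabs_le_between in I2.
  assert (HlnL : ln m <= ln (L0 m e) <= ln (2 * m)) by (split; apply ln_le; lra).
  assert (HwT0 : -1 + ln m - 2 * T0 <= w T0 <= W) by (unfold W; lra).
  assert (Hnot : ~ (forall t, T0 <= t <= T1 -> 0 < X t)).
  { intro Hpos.
    assert (Hdec : forall a b, T0 <= a -> a < b -> b <= T1 -> w b < w a).
    { intros a b Ha Hab Hb. apply (derive_neg_lt w (fun t => - X t)); [lra| |].
      - intros v _. apply Hw.
      - intros v Hv. specialize (Hpos v ltac:(lra)). lra. }
    assert (Hwb : w Tb < - 1).
    { apply Rnot_le_lt. intro Hge.
      assert (Hge' : forall t, T0 <= t <= Tb -> - (1) <= w t).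
      { intros t Ht. destruct (Rle_lt_or_eq_dec t Tb) as [Hlt|Heq]; [lra| |subst; lra].
        specialize (Hdec t Tb ltac:(lra) Hlt ltac:(lra)). lra. }
      assert (Hwin : forall c, ca <= c <= ca + 5 -> exists t, c <= t <= c + PI /\ w t = 0).
      { intros c Hc. apply (w_zero_window m e1 1 c e w X He ltac:(lra) Hsol).
        - intros t Ht. apply Hge'. unfold Tb; lra.
        - fold q. specialize (Hc1 c ltac:(lra)).
          apply Rmult_le_compat_r with (r := q) in Hc1; [|lra].
          replace ((1 + m ^ 2 / 4) / q * q) with (1 + m ^ 2 / 4) in Hc1 by (field; lra).
          exact Hc1. }
      destruct (Hwin ca ltac:(lra)) as [z1 [Hz1 Hz1']].
      destruct (Hwin (ca + 5) ltac:(lra)) as [z2 [Hz2 Hz2']].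
      specialize (Hdec z1 z2 ltac:(lra) ltac:(lra) ltac:(unfold Tb in *; lra)). lra. }
    assert (Hwlt : forall t, Tb <= t <= T1 -> w t <= - 1).
    { intros t Ht. destruct (Rle_lt_or_eq_dec Tb t) as [Hlt|Heq]; [lra| |subst; lra].
      specialize (Hdec Tb t ltac:(unfold Tb; lra) Hlt ltac:(lra)). lra. }
    assert (Hexp1 : exp (-1) <= / 2).
    { pose proof (exp_ineq1_le 1).
      assert (exp (-1) * exp 1 = 1) by (rewrite <- exp_plus; replace (-1 + 1) with 0 by ring; apply exp_0).
      pose proof (exp_pos (-1)). nra. }
    assert (HXb : X Tb <= 3 + exp (2 * Tb + W)).
    { apply (positive_phase m e w X T0 Tb W); try lra; try exact Hsol; [unfold Tb; lra|].
      intros u Hu. left. apply Hpos. lra. }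
    assert (Htd : exists td, Tb <= td <= Td /\ X td <= kp * exp td).
    { apply NNPP. intro Hno.
      assert (Hgt : forall t, Tb <= t <= Td -> kp * exp t < X t).
      { intros t Ht. apply Rnot_le_lt. intro Hle. apply Hno. exists t. split; assumption. }
      (* Above the curve, [w' = - X <= - kp * exp t]. The growth [exp (2 t + w)] allowed to [X] by
         Pohozaev is then paid for by the second summand, whose own growth [exp (t + w) / kp] is
         paid for by the third. *)
      assert (Hm1 : X Td + exp (Td + w Td) / kp + exp (w Td) / kp ^ 2
                    <= X Tb + exp (Tb + w Tb) / kp + exp (w Tb) / kp ^ 2).
      { apply (derive_nonpos_le (fun t => X t + exp (t + w t) / kp + exp (w t) / kp ^ 2)
         (fun t => e * X t ^ 2 - m * X t + exp (2 * t) * (exp (w t) - 1)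
            + exp (t + w t) * (1 - X t) / kp - exp (w t) * X t / kp ^ 2)); [lra| |].
        - intros u _. der_sol Hw HX. field. lra.
        - intros u Hu. pose proof (pohozaev m e w X ltac:(lra) ltac:(lra) Hsol u) as Hp.
          specialize (Hgt u Hu). pose proof (exp_pos u). pose proof (exp_pos (w u)).
          replace (2 * u) with (u + u) in * by ring. rewrite !exp_plus in *.
          set (s := exp u) in *. set (g := exp (w u)) in *.
          replace (s * g * (1 - X u) / kp) with (s * g / kp - s * g * X u / kp) by (field; lra).
          assert (Hsg : 0 < s * g) by nra.
          assert (E1 : s * g * (kp * s) / kp <= s * g * X u / kp).
          { apply Rmult_le_compat_r; [left; apply Rinv_0_lt_compat; lra|].
            apply Rmult_le_compat_l; lra. }
          replace (s * g * (kp * s) / kp) with (s * s * g) in E1 by (field; lra).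
          assert (E2 : g * (kp * s) / kp ^ 2 <= g * X u / kp ^ 2).
          { apply Rmult_le_compat_r; [left; apply Rinv_0_lt_compat; nra|].
            apply Rmult_le_compat_l; lra. }
          replace (g * (kp * s) / kp ^ 2) with (s * g / kp) in E2 by (field; lra).
          lra. }
      specialize (Hgt Td ltac:(lra)).
      assert (Hd1 : 0 < exp (Td + w Td) / kp) by (apply Rdiv_lt_0_compat; [apply exp_pos|lra]).
      assert (Hd2 : 0 < exp (w Td) / kp ^ 2) by (apply Rdiv_lt_0_compat; [apply exp_pos|nra]).
      assert (Hd3 : exp (Tb + w Tb) / kp <= exp Tb / kp).
      { apply Rmult_le_compat_r; [left; apply Rinv_0_lt_compat; lra|]. apply exp_le. lra. }
      assert (Hd4 : exp (w Tb) / kp ^ 2 <= / kp ^ 2).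
      { rewrite <- (Rmult_1_l (/ kp ^ 2)).
        apply Rmult_le_compat_r; [left; apply Rinv_0_lt_compat; nra|].
        rewrite <- exp_0. apply exp_le. lra. }
      unfold K in HTdK. lra. }
    destruct Htd as [td [Htd1 Htd2]].
    assert (Hder : forall u, td <= u <= T1 -> X u <= kp * exp u ->
       e * X u ^ 2 - m * X u + exp (2 * u) * (exp (w u) - 1) <= - exp (2 * u) / 4).
    { intros u Hu Hle. specialize (Hpos u ltac:(unfold Tb in *; lra)).
      specialize (Hwlt u ltac:(lra)).
      assert (exp (w u) <= / 2) by (apply Rle_trans with (exp (-1)); [apply exp_le; lra|lra]).
      pose proof (exp_pos u). pose proof (exp_pos (w u)).
      replace (2 * u) with (u + u) in * by ring. rewrite !exp_plus in *.
      set (s := exp u) in *.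
      assert (X u ^ 2 <= kp ^ 2 * (s * s)).
      { replace (kp ^ 2 * (s * s)) with ((kp * s) ^ 2) by ring. apply pow_incr. lra. }
      assert (e * X u ^ 2 <= e1 * (kp ^ 2 * (s * s))).
      { apply Rmult_le_compat; try lra. apply pow2_ge_0. }
      assert (0 < s * s) by nra.
      assert (e1 * (kp ^ 2 * (s * s)) <= / 4 * (s * s)).
      { replace (e1 * (kp ^ 2 * (s * s))) with (kp ^ 2 * e1 * (s * s)) by ring.
        apply Rmult_le_compat_r; lra. }
      assert (0 <= m * X u) by (apply Rmult_le_pos; lra).
      assert (s * s * (exp (w u) - 1) <= s * s * (- / 2)) by (apply Rmult_le_compat_l; lra).
      lra. }
    assert (Hstay : forall u, td <= u <= T1 -> X u - kp * exp u <= 0).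
    { apply (barrier (fun u => X u - kp * exp u)
        (fun u => e * X u ^ 2 - m * X u + exp (2 * u) * (exp (w u) - 1) - kp * exp u)).
      - intros u _. der_sol Hw HX. ring.
      - lra.
      - intros u Hu H0. specialize (Hder u Hu ltac:(lra)).
        pose proof (exp_pos u). pose proof (exp_pos (2 * u)).
        assert (0 < kp * exp u) by nra. lra. }
    assert (Hfin : X T1 + exp (2 * T1) / 8 <= X td + exp (2 * td) / 8).
    { apply (derive_nonpos_le (fun u => X u + exp (2 * u) / 8)
        (fun u => e * X u ^ 2 - m * X u + exp (2 * u) * (exp (w u) - 1) + exp (2 * u) / 4)).
      - lra.
      - intros u _. der_sol Hw HX. field.
      - intros u Hu. specialize (Hstay u Hu). specialize (Hder u Hu ltac:(lra)). lra. }
    specialize (Hpos T1 ltac:(unfold Tb in *; lra)).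
    assert (exp td <= exp Td) by (apply exp_le; lra).
    assert (exp (2 * td) <= exp (2 * Td)) by (apply exp_le; lra).
    assert (kp * exp td <= kp * exp Td) by (apply Rmult_le_compat_l; lra).
    lra. }
  assert (Hex : exists t, T0 <= t <= T1 /\ X t <= 0).
  { apply NNPP. intro Hno. apply Hnot. intros t Ht. apply Rnot_le_lt. intro Hle.
    apply Hno. exists t. split; assumption. }
  destruct Hex as [t [Ht1 Ht2]].
  destruct (first_zero X T0 t) as [t1 [K1 [K2 K3]]]; try lra.
  { intros u _. apply (sol_cont_X m e w X u Hsol). }
  exists t1. split; [lra|]. split; [exact K2|].
  assert (Hpre : forall u, u < t1 -> 0 < X u).
  { intros u Hu. destruct (Rle_lt_dec T0 u) as [Hle|Hlt]; [apply K3; lra|].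
    destruct (HT0 e w X He Hsol u ltac:(lra)) as [J1 _]. apply Rabs_le_between in J1. lra. }
  split; [exact Hpre|].
  assert (Hph : forall u, T0 <= u <= t1 -> w u <= w T0 /\ X u <= B).
  { intros u Hu.
    destruct (positive_phase m e w X T0 u W ltac:(lra) ltac:(lra) Hsol ltac:(lra)) as [J1 J2];
      try lra.
    - intros v Hv. destruct (Rle_lt_or_eq_dec v t1) as [Hlt|Heq]; [lra| |subst; lra].
      left. apply Hpre, Hlt.
    - split; [exact J1|]. unfold B.
      assert (exp (2 * u + W) <= exp (2 * T1 + W)) by (apply exp_le; lra). lra. }
  intros u Hu. destruct (Hph u Hu) as [J1 J2]. split; [exact J2|].
  assert (Hlow : - (w u + B * u) <= - (w T0 + B * T0)).
  { apply (derive_nonpos_le (fun u => - (w u + B * u)) (fun u => - (- X u + B))); [lra| |].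
    - intros v _. der_sol Hw HX. ring.
    - intros v Hv. destruct (Hph v ltac:(lra)). lra. }
  assert (B * (u - T0) <= (T1 - T0) * B) by (rewrite Rmult_comm; apply Rmult_le_compat_r; lra).
  pose proof (Rle_abs W). pose proof (Rabs_pos W).
  pose proof (Rabs_maj2 (-1 + ln m - 2 * T0)). pose proof (Rabs_pos (-1 + ln m - 2 * T0)).
  assert (0 <= (T1 - T0) * B) by (apply Rmult_le_pos; lra).
  lra.
Qed.

(** * Energy *)

(** With [u = exp (e v)], this is [(u^(p+1) / (p+1) - u^2 / 2) / e] up to a constant that makes it
    vanish at [u = 1]. *)
Definition pot (e v : R) : R :=
  (exp ((1 + 2 * e) * v) - 1) / (1 + 2 * e) - (exp (2 * e * v) - 1) / (2 * e).

Lemma pot_derive (e v : R) : 0 < e ->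
  is_derive (pot e) v (exp (2 * e * v) * (exp v - 1)).
Proof.
  intros He. unfold pot. auto_derive; [lra|].
  replace ((1 + 2 * e) * v) with (2 * e * v + v) by ring.
  rewrite exp_plus. field. lra.
Qed.

Lemma pot_0 (e : R) : 0 < e -> pot e 0 = 0.
Proof. intros He. unfold pot. rewrite !Rmult_0_r, exp_0. field. lra. Qed.

Lemma pot_decr (e a b : R) : 0 < e -> a < b -> b <= 0 -> pot e b < pot e a.
Proof.
  intros He Hab Hb. apply (derive_neg_lt _ (fun v => exp (2 * e * v) * (exp v - 1)) a b Hab).
  - intros v _. apply pot_derive, He.
  - intros v Hv. pose proof (exp_pos (2 * e * v)).
    assert (exp v < 1) by (rewrite <- exp_0; apply exp_increasing; lra). nra.
Qed.

(** Coercivity free of [e]: the derivative is at least [v], since [exp (2 e v) >= 1] and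
    [exp v - 1 >= v]. *)
Lemma pot_ge_sq (e v : R) : 0 < e -> 0 <= v -> v ^ 2 / 2 <= pot e v.
Proof.
  intros He Hv.
  assert (K : v ^ 2 / 2 - pot e v <= 0 ^ 2 / 2 - pot e 0).
  { apply (derive_nonpos_le (fun v => v ^ 2 / 2 - pot e v)
      (fun v => v - exp (2 * e * v) * (exp v - 1))); [exact Hv| |].
    - intros u _. apply (is_derive_minus (fun v => v ^ 2 / 2) (pot e)).
      + auto_derive; [exact I|field].
      + apply pot_derive, He.
    - intros u Hu. pose proof (exp_ineq1_le u). pose proof (exp_ineq1_le (2 * e * u)).
      assert (0 <= 2 * e * u) by nra. nra. }
  rewrite pot_0 in K by exact He. lra.
Qed.

(** On the negative side the derivative is at least [-1], whatever [e] is. *)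
Lemma pot_neg_le (e k : R) : 0 < e -> 0 <= k -> pot e (- k) <= k.
Proof.
  intros He Hk.
  assert (K : - (pot e 0 + 0) <= - (pot e (- k) + - k)).
  { apply (derive_nonpos_le (fun v => - (pot e v + v))
      (fun v => - (exp (2 * e * v) * (exp v - 1) + 1))); [lra| |].
    - intros u _. apply (is_derive_opp (fun v => pot e v + v)).
      apply (is_derive_plus (pot e) (fun v => v)).
      + apply pot_derive, He.
      + apply (is_derive_id (K := R_AbsRing)).
    - intros u Hu. pose proof (exp_pos u). pose proof (exp_pos (2 * e * u)).
      assert (exp (2 * e * u) <= 1) by (rewrite <- exp_0; apply exp_le; nra).
      assert (exp u <= 1) by (rewrite <- exp_0; apply exp_le; lra). nra. }
  rewrite pot_0 in K by exact He. lra.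
Qed.

Lemma pot_nonneg (e v : R) : 0 < e -> 0 <= pot e v.
Proof.
  intros He. destruct (Rle_lt_dec 0 v) as [H|H].
  - pose proof (pot_ge_sq e v He H). pose proof (pow2_ge_0 v). lra.
  - pose proof (pot_decr e v 0 He H ltac:(lra)). rewrite pot_0 in H0 by exact He. lra.
Qed.

Lemma pot_eq_0 (e v : R) : 0 < e -> pot e v <= 0 -> v = 0.
Proof.
  intros He Hp. destruct (Rtotal_order v 0) as [H|[H|H]]; [|exact H|].
  - pose proof (pot_decr e v 0 He H ltac:(lra)). rewrite pot_0 in H0 by exact He. lra.
  - pose proof (pot_ge_sq e v He ltac:(lra)). nra.
Qed.

(** The radial energy [(u'^2 / 2 + u^(p+1) / (p+1) - u^2 / 2) / e] up to a constant;
    [exp (- (2 * t))] comes from differentiating in [r] rather than in [t]. *)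
Definition energy (e : R) (w X : R -> R) (t : R) : R :=
  exp (2 * e * w t) * X t ^ 2 * exp (- (2 * t)) / 2 + pot e (w t).

Lemma energy_derive (m e : R) (w X : R -> R) (t : R) : 0 < e -> singular_sol m e w X ->
  is_derive (energy e w X) t (- (m + 1) * (exp (2 * e * w t) * X t ^ 2 * exp (- (2 * t)))).
Proof.
  intros He [Hw [HX _]]. unfold energy, pot. der_sol Hw HX.
  rewrite exp_Ropp. pose proof (exp_pos (2 * t)).
  replace ((1 + 2 * e) * w t) with (2 * e * w t + w t) by ring. rewrite exp_plus.
  field. lra.
Qed.

Lemma energy_decr (m e : R) (w X : R -> R) (s t : R) :
  0 < m -> 0 < e -> singular_sol m e w X -> s <= t -> energy e w X t <= energy e w X s.
Proof.
  intros Hm He Hsol Hst. apply (derive_nonpos_le _ _ _ _ Hst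
    (fun t _ => energy_derive m e w X t He Hsol)).
  intros u _. pose proof (exp_pos (2 * e * w u)). pose proof (exp_pos (- (2 * u))).
  assert (0 <= exp (2 * e * w u) * X u ^ 2 * exp (- (2 * u))); [|nra].
  apply Rmult_le_pos; [apply Rmult_le_pos; [lra|apply pow2_ge_0]|lra].
Qed.

Lemma kinetic_nonneg (e : R) (w X : R -> R) (t : R) :
  0 <= exp (2 * e * w t) * X t ^ 2 * exp (- (2 * t)).
Proof.
  pose proof (exp_pos (2 * e * w t)). pose proof (exp_pos (- (2 * t))).
  apply Rmult_le_pos; [apply Rmult_le_pos; [lra|apply pow2_ge_0]|lra].
Qed.

(* [exp (2 (m+1) t) * energy] is nondecreasing, so the energy cannot vanish
   without vanishing on a whole half-line [(-oo, t]]. *)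
Lemma energy_pos (m e : R) (w X : R -> R) (t : R) :
  0 < m -> 0 < e -> singular_sol m e w X -> 0 < energy e w X t.
Proof.
  intros Hm He Hsol. apply Rnot_le_lt. intro Hle.
  assert (Hz : forall s, s <= t -> w s = 0).
  { intros s Hs.
    assert (K : - (exp (2 * (m + 1) * t) * energy e w X t)
                <= - (exp (2 * (m + 1) * s) * energy e w X s)).
    { apply (derive_nonpos_le (fun t => - (exp (2 * (m + 1) * t) * energy e w X t))
         (fun t => - (exp (2 * (m + 1) * t) * (2 * (m + 1) * pot e (w t))))); [exact Hs| |].
      - intros u _. apply (is_derive_opp (fun t => exp (2 * (m + 1) * t) * energy e w X t)).
        assert (E := is_derive_unique _ _ _ (energy_derive m e w X u He Hsol)).
        auto_derive.
        + eexists. apply (energy_derive m e w X u He Hsol).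
        + change (Derive (fun x => energy e w X x) u) with (Derive (energy e w X) u).
          rewrite E. unfold energy. field.
      - intros u _. pose proof (exp_pos (2 * (m + 1) * u)). pose proof (pot_nonneg e (w u) He).
        assert (0 <= exp (2 * (m + 1) * u) * (2 * (m + 1) * pot e (w u))); [|lra].
        apply Rmult_le_pos; [lra|apply Rmult_le_pos; lra]. }
    pose proof (exp_pos (2 * (m + 1) * t)). pose proof (exp_pos (2 * (m + 1) * s)).
    assert (Hes : energy e w X s <= 0) by nra.
    apply (pot_eq_0 e); [exact He|].
    pose proof (kinetic_nonneg e w X s). unfold energy in Hes. lra. }
  destruct Hsol as [_ [_ Hlim]]. destruct (Hlim 1 ltac:(lra)) as [T HT].
  set (s := Rmin (Rmin t T) ((ln (L0 m e) - 1) / 2)).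
  assert (s <= Rmin t T) by apply Rmin_l.
  assert (s <= (ln (L0 m e) - 1) / 2) by apply Rmin_r.
  pose proof (Rmin_l t T). pose proof (Rmin_r t T).
  specialize (HT s ltac:(lra)). rewrite (Hz s ltac:(lra)) in HT.
  apply Rabs_def2 in HT. lra.
Qed.

(** Positive energy excludes [w = X = 0]. Hence at a zero of [X] the derivative
    [exp (2 t) (exp w - 1)] is nonzero, which is the simplicity of these zeros. *)
Lemma crit_w_nonzero (m e : R) (w X : R -> R) (t : R) :
  0 < m -> 0 < e -> singular_sol m e w X -> X t = 0 -> w t <> 0.
Proof.
  intros Hm He Hsol HX Hw. pose proof (energy_pos m e w X t Hm He Hsol) as H.
  unfold energy in H. rewrite HX, Hw, pot_0 in H by exact He. lra.
Qed.

(** At [t1] the energy is purely potential and at most [k]; afterwards it only decreases. In use,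
    [t1] is the first critical point. *)
Lemma tail_bounds (m e k : R) (w X : R -> R) (t1 : R) :
  0 < m -> 0 < e -> 0 <= k -> singular_sol m e w X ->
  X t1 = 0 -> - k <= w t1 <= 0 ->
  forall t, t1 <= t -> - k <= w t <= k + 1 /\ X t ^ 2 <= 2 * k * exp (2 * t) * exp (2 * e * k).
Proof.
  intros Hm He Hk Hsol HX Hw t Ht.
  pose proof (energy_decr m e w X t1 t Hm He Hsol Ht) as Hen.
  unfold energy in Hen. rewrite HX in Hen.
  pose proof (kinetic_nonneg e w X t) as Hkin.
  replace (exp (2 * e * w t1) * 0 ^ 2 * exp (- (2 * t1)) / 2) with 0 in Hen by field.
  assert (Hpk : pot e (w t1) <= k).
  { destruct (Rle_lt_or_eq_dec (- k) (w t1)) as [Hlt|Heq]; [lra| |].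
    - pose proof (pot_decr e (- k) (w t1) He Hlt ltac:(lra)).
      pose proof (pot_neg_le e k He Hk). lra.
    - rewrite <- Heq. apply pot_neg_le; assumption. }
  assert (Hlow : - k <= w t).
  { apply Rnot_lt_le. intro Hlt.
    pose proof (pot_decr e (w t) (w t1) He ltac:(lra) ltac:(lra)). lra. }
  split; [split; [exact Hlow|]|].
  - destruct (Rle_lt_dec (w t) 0) as [H|H]; [lra|].
    pose proof (pot_ge_sq e (w t) He ltac:(lra)). nra.
  - pose proof (pot_nonneg e (w t) He).
    assert (Hq : exp (2 * e * w t) * X t ^ 2 * exp (- (2 * t)) <= 2 * k) by lra.
    pose proof (exp_pos (2 * t)). pose proof (exp_pos (2 * e * k)).
    assert (E1 : exp (- (2 * t)) * exp (2 * t) = 1).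
    { rewrite <- exp_plus. replace (- (2 * t) + 2 * t) with 0 by ring. apply exp_0. }
    assert (E2 : 1 <= exp (2 * e * w t) * exp (2 * e * k)).
    { rewrite <- exp_plus, <- exp_0. apply exp_le. nra. }
    apply Rmult_le_compat_r with (r := exp (2 * t) * exp (2 * e * k)) in Hq; [|nra].
    replace (exp (2 * e * w t) * X t ^ 2 * exp (- (2 * t)) * (exp (2 * t) * exp (2 * e * k)))
      with (X t ^ 2 * (exp (2 * e * w t) * exp (2 * e * k)) * (exp (- (2 * t)) * exp (2 * t)))
      in Hq by ring.
    rewrite E1 in Hq. pose proof (pow2_ge_0 (X t)). nra.
Qed.

Lemma first_crit_w_neg (m e : R) (w X : R -> R) (t1 : R) :
  0 < m -> 0 < e -> singular_sol m e w X ->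
  X t1 = 0 -> (forall t, t < t1 -> 0 < X t) -> w t1 < 0.
Proof.
  intros Hm He Hsol H0 Hpos.
  pose proof (crit_w_nonzero m e w X t1 Hm He Hsol H0) as Hne.
  apply Rnot_le_lt. intro Hle. destruct Hsol as [_ [HX _]]. specialize (HX t1).
  rewrite H0 in HX. pose proof (exp_pos (2 * t1)).
  assert (1 < exp (w t1)) by (rewrite <- exp_0; apply exp_increasing; lra).
  destruct (derive_sign_right X t1 _ HX H0 ltac:(nra)) as [d [Hd [_ Hd2]]].
  specialize (Hd2 (t1 - d / 2) ltac:(lra)). specialize (Hpos (t1 - d / 2) ltac:(lra)). lra.
Qed.

(** Past [Ts] mere boundedness by [M] suffices, as [exp (2 * t) >= exp (2 * Ts)]; hence the summand
    [M / exp (2 * Ts)]. The weight [exp (2 * t)] is kept because it makes the later Gronwall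
    coefficient integrable at [-oo]. *)
Lemma global_bound (m e1 T : R) : 0 < e1 -> 4 * e1 < m ->
  exists C, 0 < C /\ forall e w X, 0 < e <= e1 -> singular_sol m e w X ->
    forall t, t <= T ->
      Rabs (2 - X t) <= C * exp (2 * t) /\
      Rabs (w t + 2 * t - ln (L0 m e)) <= C * exp (2 * t).
Proof.
  intros He1 Hm.
  destruct (start_bound m e1 He1 Hm) as [Ts [C0 [HC0 Hst]]].
  destruct (first_crit_uniform m e1 He1 Hm) as [T0 [T1 [k [B [HT01 [Hk [HB Hfc]]]]]]].
  set (D := 2 * k * exp (2 * T) * exp (2 * e1 * k)).
  assert (HD : 0 <= D).
  { unfold D. pose proof (exp_pos (2 * T)). pose proof (exp_pos (2 * e1 * k)).
    apply Rmult_le_pos; [apply Rmult_le_pos; lra|lra]. }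
  set (M := 4 + B + D + k + 2 * (Rabs T0 + Rabs T) + (Rabs (ln m) + Rabs (ln (2 * m)))).
  assert (HM : 4 + B + D <= M /\ k + 1 + 2 * (Rabs T0 + Rabs T) + (Rabs (ln m) + Rabs (ln (2 * m))) <= M).
  { unfold M. pose proof (Rabs_pos T0). pose proof (Rabs_pos T).
    pose proof (Rabs_pos (ln m)). pose proof (Rabs_pos (ln (2 * m))). lra. }
  assert (HM0 : 0 < M) by lra.
  pose proof (exp_pos (2 * Ts)) as Hes.
  exists (C0 + M / exp (2 * Ts)). split.
  { assert (0 < M / exp (2 * Ts)) by (apply Rdiv_lt_0_compat; lra). lra. }
  intros e w X He Hsol t Ht.
  pose proof (L0_pos m e e1 Hm He) as HL.
  assert (HlnL : ln m <= ln (L0 m e) <= ln (2 * m)) by (split; apply ln_le; lra).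
  pose proof (exp_pos (2 * t)) as Het.
  assert (HMt : 0 < M / exp (2 * Ts) * exp (2 * t)).
  { apply Rmult_lt_0_compat; [apply Rdiv_lt_0_compat|]; lra. }
  assert (HCt : 0 < C0 * exp (2 * t)) by nra.
  rewrite Rmult_plus_distr_r.
  destruct (Rle_lt_dec t Ts) as [Hts|Hts].
  { destruct (Hst e w X He Hsol t Hts). split; lra. }
  assert (HMle : M <= M / exp (2 * Ts) * exp (2 * t)).
  { assert (exp (2 * Ts) <= exp (2 * t)) by (apply exp_le; lra).
    replace M with (M / exp (2 * Ts) * exp (2 * Ts)) at 1 by (field; lra).
    apply Rmult_le_compat_l; [|lra]. left. apply Rdiv_lt_0_compat; lra. }
  enough (Rabs (2 - X t) <= M /\ Rabs (w t + 2 * t - ln (L0 m e)) <= M) by (split; lra).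
  destruct (Hfc e w X He Hsol) as [Hunit [t1 [Ht1 [H0 [Hpos Hmid]]]]].
  assert (HM1 : 1 <= M).
  { lra. }
  destruct (Rle_lt_dec t T0) as [Ht0|Ht0].
  { destruct (Hunit t Ht0). split; lra. }
  assert (Hwx : - (k + 1) <= w t <= k + 1 /\ - (1 + D) <= X t <= B + 1 + D).
  { destruct (Rle_lt_dec t t1) as [Htt|Htt].
    - destruct (Hmid t ltac:(lra)) as [J1 J2].
      assert (0 <= X t).
      { destruct (Rle_lt_or_eq_dec t t1 Htt) as [Hlt|Heq]; [left; apply Hpos, Hlt|subst; lra]. }
      lra.
    - pose proof (first_crit_w_neg m e w X t1 ltac:(lra) ltac:(lra) Hsol H0 Hpos).
      destruct (Hmid t1 ltac:(lra)) as [_ J2].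
      destruct (tail_bounds m e k w X t1 ltac:(lra) ltac:(lra) Hk Hsol H0 ltac:(lra) t ltac:(lra))
        as [J3 J4].
      assert (X t ^ 2 <= D).
      { apply Rle_trans with (1 := J4). unfold D. rewrite !Rmult_assoc.
        apply Rmult_le_compat_l; [lra|]. apply Rmult_le_compat_l; [lra|].
        pose proof (exp_pos (2 * (e * k))).
        apply Rmult_le_compat; try lra; apply exp_le; nra. }
      split; [lra|]. nra. }
  split.
  - apply Rabs_le. lra.
  - pose proof (Rle_abs T). pose proof (Rabs_pos T).
    pose proof (Rabs_maj2 T0). pose proof (Rabs_pos T0).
    pose proof (Rabs_maj2 (ln m)). pose proof (Rabs_pos (ln m)).
    pose proof (Rle_abs (ln (2 * m))). pose proof (Rabs_pos (ln (2 * m))).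
    apply Rabs_le. lra.
Qed.

(** * Lipschitz dependence on the exponent *)

Lemma exp_sub_1_bound (c G M : R) : Rabs c <= G -> G <= M -> Rabs (exp c - 1) <= G * exp M.
Proof.
  intros Hc HG. apply Rabs_le_between in Hc.
  assert (1 <= exp M) by (rewrite <- exp_0; apply exp_le; lra).
  assert (E : exp c * exp (- c) = 1).
  { rewrite <- exp_plus. replace (c + - c) with 0 by ring. apply exp_0. }
  pose proof (exp_ineq1_le c). pose proof (exp_ineq1_le (- c)). pose proof (exp_pos c).
  assert (G <= G * exp M) by nra.
  apply Rabs_le. split; [lra|].
  destruct (Rle_lt_dec 0 c) as [H4|H4].
  - assert (exp c - 1 <= c * exp c) by nra.
    assert (c * exp c <= G * exp M); [|lra].
    apply Rmult_le_compat; try lra. apply exp_le. lra.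
  - assert (exp c < 1) by (rewrite <- exp_0; apply exp_increasing; lra). lra.
Qed.

(** Mean value theorem for [exp x - x]. The linearisation error keeps the small factor [G], which
    plain Lipschitz continuity of [exp] would lose. *)
Lemma exp_diff_bound (a b G M : R) : Rabs a <= G -> Rabs b <= G -> G <= M ->
  Rabs (exp a - exp b - (a - b)) <= G * exp M * Rabs (a - b).
Proof.
  intros Ha Hb HG.
  destruct (MVT_gen (fun x => exp x - x) b a (fun x => exp x - 1)) as [c [Hc1 Hc2]].
  - intros x _. auto_derive; [exact I|ring].
  - intros x _. apply continuity_pt_filterlim,
      (ex_derive_continuous (V := R_NormedModule) (fun x => exp x - x)).
    auto_derive. exact I.
  - replace (exp a - exp b - (a - b)) with ((exp c - 1) * (a - b)) by lra.
    rewrite Rabs_mult. apply Rmult_le_compat_r; [apply Rabs_pos|].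
    apply exp_sub_1_bound; [|exact HG].
    apply Rabs_le_between in Ha. apply Rabs_le_between in Hb.
    apply Rabs_le. revert Hc1. unfold Rmin, Rmax. destruct (Rle_dec b a); lra.
Qed.

Lemma ln_diff_bound (x y m : R) : 0 < m -> m <= x -> m <= y ->
  Rabs (ln x - ln y) <= Rabs (x - y) / m.
Proof.
  intros Hm Hx Hy.
  assert (K : forall x y, m <= x -> m <= y -> ln x - ln y <= Rabs (x - y) / m).
  { clear x y Hx Hy. intros x y Hx Hy.
    assert (ln x - ln y <= (x - y) / y).
    { rewrite <- ln_div by lra. pose proof (exp_ineq1_le (ln (x / y))) as H.
      rewrite exp_ln in H by (apply Rdiv_lt_0_compat; lra).
      replace ((x - y) / y) with (x / y - 1) by (field; lra). lra. }
    apply Rle_trans with (1 := H).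
    apply Rle_trans with (Rabs (x - y) / y).
    - apply Rmult_le_compat_r; [left; apply Rinv_0_lt_compat; lra|apply Rle_abs].
    - apply Rmult_le_compat_l; [apply Rabs_pos|apply Rinv_le_contravar; lra]. }
  apply Rabs_le. split; [|apply K; assumption].
  specialize (K y x Hy Hx). rewrite Rabs_minus_sym in K. lra.
Qed.

(* A Gronwall argument started at [-oo]: the difference of two solutions tends
   to [0] there, and all perturbation terms carry the integrable factor [exp (2 t)]. *)
Lemma sol_lipschitz (m e1 T : R) : 0 < e1 -> 4 * e1 < m ->
  exists K, 0 < K /\ forall ea eb wa Xa wb Xb,
    0 < ea <= e1 -> 0 < eb <= e1 ->
    singular_sol m ea wa Xa -> singular_sol m eb wb Xb ->
    forall t, t <= T ->
      Rabs (wa t - wb t) <= K * Rabs (ea - eb) /\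
      Rabs (Xa t - Xb t) <= K * Rabs (ea - eb).
Proof.
  intros He1 Hm. destruct (global_bound m e1 T He1 Hm) as [C [HC Hgb]].
  set (M := C * exp (2 * T)). pose proof (exp_pos M) as HeM.
  assert (HM : 0 < M) by (unfold M; pose proof (exp_pos (2 * T)); nra).
  set (A := 4 + 2 * e1 + M + 2 * m * exp M + 4 * exp M).
  assert (HA : 0 < A) by (unfold A; nra).
  set (A2 := A * (4 + / m)).
  assert (Him : 0 < / m) by (apply Rinv_0_lt_compat; lra).
  assert (HA2 : 0 < A2) by (unfold A2; nra).
  set (E := exp (A2 * C / 2 * exp (2 * T))). assert (HE : 0 < E) by apply exp_pos.
  exists (1 + 2 * E + 2 * E / m + 4 / m).
  assert (HEm : 0 < 2 * E / m) by (apply Rdiv_lt_0_compat; lra).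
  assert (H4m : 0 < 4 / m) by (apply Rdiv_lt_0_compat; lra).
  split; [lra|].
  intros ea eb wa Xa wb Xb Hea Heb Ha Hb t Ht.
  pose proof (L0_pos m ea e1 Hm Hea) as HLa. pose proof (L0_pos m eb e1 Hm Heb) as HLb.
  set (D := Rabs (ea - eb)).
  assert (HD : 0 <= D) by apply Rabs_pos.
  set (La := L0 m ea) in *. set (Lb := L0 m eb) in *.
  pose proof (Hgb ea wa Xa Hea Ha) as Ba. pose proof (Hgb eb wb Xb Heb Hb) as Bb.
  fold La in Ba. fold Lb in Bb.
  pose proof Ha as [Hwa [HXa _]]. pose proof Hb as [Hwb [HXb _]].
  (* Measured against their own limits, both solutions tend to [0], so [d] and [p] vanish at [-oo];
     the forcing [exp (2 t)] is common to both and cancels. *)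
  set (d := fun t => (wa t + 2 * t - ln La) - (wb t + 2 * t - ln Lb)).
  set (p := fun t => (2 - Xa t) - (2 - Xb t)).
  set (dp := fun t => - (ea * Xa t ^ 2 - m * Xa t + exp (2 * t) * (exp (wa t) - 1))
                      + (eb * Xb t ^ 2 - m * Xb t + exp (2 * t) * (exp (wb t) - 1))).
  (* Energy of the linearisation at the rest state, with stiffness [La]; its damping
     [- (m - 4 * ea) * p^2] has the good sign. *)
  set (Q := fun t => p t ^ 2 / 2 + La * d t ^ 2 / 2).
  assert (Hdd : forall u, is_derive d u (p u)).
  { intros u. unfold d, p. replace (2 - Xa u - (2 - Xb u)) with (- Xa u + 2 - (- Xb u + 2)) by ring.
    apply (is_derive_minus (fun t => wa t + 2 * t - ln La) (fun t => wb t + 2 * t - ln Lb)).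
    - der_sol Hwa HXa. ring.
    - der_sol Hwb HXb. ring. }
  assert (Hdp : forall u, is_derive p u (dp u)).
  { intros u. unfold p, dp.
    replace (- (ea * Xa u ^ 2 - m * Xa u + exp (2 * u) * (exp (wa u) - 1)) +
       (eb * Xb u ^ 2 - m * Xb u + exp (2 * u) * (exp (wb u) - 1)))
      with (- (ea * Xa u ^ 2 - m * Xa u + exp (2 * u) * (exp (wa u) - 1)) -
       (- (eb * Xb u ^ 2 - m * Xb u + exp (2 * u) * (exp (wb u) - 1)))) by ring.
    apply (is_derive_minus (fun t => 2 - Xa t) (fun t => 2 - Xb t)).
    - der_sol Hwa HXa. ring.
    - der_sol Hwb HXb. ring. }
  assert (HdQ : forall u, is_derive Q u (p u * (dp u + La * d u))).
  { intros u. unfold Q. der_sol Hdd Hdp. field. }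
  assert (Hbnd : forall u, u <= T ->
     p u * (dp u + La * d u) <= A2 * (C * exp (2 * u)) * (Q u + D ^ 2)).
  { intros u Hu. destruct (Ba u Hu) as [Y1 Y2]. destruct (Bb u Hu) as [Z1 Z2].
    pose proof (exp_sol_split m ea (wa u) u ltac:(fold La; lra)) as Sa. fold La in Sa.
    pose proof (exp_sol_split m eb (wb u) u ltac:(fold Lb; lra)) as Sb. fold Lb in Sb.
    set (G := C * exp (2 * u)) in *.
    assert (HG : 0 < G) by (unfold G; pose proof (exp_pos (2 * u)); nra).
    assert (HGM : G <= M).
    { unfold G, M. apply Rmult_le_compat_l; [lra|apply exp_le; lra]. }
    set (ha := wa u + 2 * u - ln La) in *. set (hb := wb u + 2 * u - ln Lb) in *.
    set (ya := 2 - Xa u) in *. set (yb := 2 - Xb u) in *.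
    assert (Hp : p u = ya - yb) by reflexivity.
    assert (Hd : d u = ha - hb) by reflexivity.
    (* What the linear part leaves over: the change of damping, the quadratic term in two pieces,
       the nonlinearity of [exp], and the change of [L0]. Each carries the factor [G]. *)
    set (r1 := 4 * (ea - eb) * yb). set (r2 := ea * (ya + yb) * (ya - yb)).
    set (r3 := (ea - eb) * yb ^ 2). set (r4 := La * (exp ha - exp hb - (ha - hb))).
    set (r5 := 4 * (ea - eb) * (exp hb - 1)).
    assert (Hexp : dp u + La * d u = - (m - 4 * ea) * p u + (r1 - r2 - r3 - r4 + r5)).
    { unfold dp. rewrite Rmult_minus_distr_l, Sa, Rmult_minus_distr_l, Sb, Hp, Hd.
      unfold r1, r2, r3, r4, r5.
      replace (Xa u) with (2 - ya) by (unfold ya; ring).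
      replace (Xb u) with (2 - yb) by (unfold yb; ring).
      unfold La, Lb, L0. ring. }
    rewrite Hexp.
    set (P := Rabs (p u)). set (N := Rabs (d u)).
    assert (HP : 0 <= P) by apply Rabs_pos. assert (HN : 0 <= N) by apply Rabs_pos.
    assert (R1 : Rabs r1 <= G * (4 * D)).
    { unfold r1. rewrite !Rabs_mult, (Rabs_right 4) by lra. fold D. nra. }
    assert (R2 : Rabs r2 <= G * (2 * e1 * P)).
    { unfold r2. rewrite !Rabs_mult, (Rabs_right ea) by lra. rewrite <- Hp. fold P.
      pose proof (Rabs_triang ya yb). pose proof (Rabs_pos (ya + yb)).
      assert (ea * Rabs (ya + yb) <= e1 * (2 * G)) by (apply Rmult_le_compat; lra).
      assert (ea * Rabs (ya + yb) * P <= e1 * (2 * G) * P) by (apply Rmult_le_compat_r; lra).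
      lra. }
    assert (R3 : Rabs r3 <= G * (M * D)).
    { unfold r3. rewrite Rabs_mult. fold D.
      rewrite (Rabs_right (yb ^ 2)) by (apply Rle_ge, pow2_ge_0).
      rewrite <- (pow2_abs yb). pose proof (Rabs_pos yb).
      assert (Rabs yb ^ 2 <= G * M) by nra. nra. }
    assert (R4 : Rabs r4 <= G * (2 * m * exp M * N)).
    { unfold r4. rewrite Rabs_mult, (Rabs_right La) by lra.
      pose proof (exp_diff_bound ha hb G M Y2 Z2 HGM) as Hx. rewrite <- Hd in Hx. fold N in Hx.
      rewrite <- Hd.
      apply Rle_trans with (2 * m * (G * exp M * N)); [|lra].
      apply Rmult_le_compat; try lra. apply Rabs_pos. }
    assert (R5 : Rabs r5 <= G * (4 * exp M * D)).
    { unfold r5. rewrite !Rabs_mult, (Rabs_right 4) by lra. fold D.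
      pose proof (exp_sub_1_bound hb G M Z2 HGM) as Hx.
      apply Rle_trans with (4 * D * (G * exp M)); [|lra].
      apply Rmult_le_compat_l; lra. }
    assert (Hr : Rabs (r1 - r2 - r3 - r4 + r5) <= G * (A * (D + P + N))).
    { assert (Ht5 : Rabs (r1 - r2 - r3 - r4 + r5) <= Rabs r1 + Rabs r2 + Rabs r3 + Rabs r4 + Rabs r5).
      { apply Rabs_le_between in R1.
        pose proof (Rle_abs r1). pose proof (Rle_abs r2). pose proof (Rle_abs r3).
        pose proof (Rle_abs r4). pose proof (Rle_abs r5).
        pose proof (Rabs_maj2 r1). pose proof (Rabs_maj2 r2). pose proof (Rabs_maj2 r3).
        pose proof (Rabs_maj2 r4). pose proof (Rabs_maj2 r5). apply Rabs_le. lra. }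
      apply Rle_trans with (1 := Ht5).
      apply Rle_trans with (G * (4 * D + 2 * e1 * P + M * D + 2 * m * exp M * N + 4 * exp M * D));
        [lra|].
      apply Rmult_le_compat_l; [lra|].
      assert (Hme : 0 < m * exp M) by (apply Rmult_lt_0_compat; lra).
      assert (X1 : (4 + M + 4 * exp M) * D <= A * D) by (apply Rmult_le_compat_r; unfold A; lra).
      assert (X2 : 2 * e1 * P <= A * P) by (apply Rmult_le_compat_r; unfold A; lra).
      assert (X3 : 2 * m * exp M * N <= A * N) by (apply Rmult_le_compat_r; unfold A; lra).
      lra. }
    assert (Hpr : p u * (r1 - r2 - r3 - r4 + r5) <= P * (G * (A * (D + P + N)))).
    { apply Rle_trans with (1 := Rle_abs _). rewrite Rabs_mult. fold P.
      apply Rmult_le_compat_l; assumption. }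
    assert (HP2 : p u ^ 2 = P ^ 2) by (unfold P; symmetry; apply pow2_abs).
    assert (HN2 : d u ^ 2 = N ^ 2) by (unfold N; symmetry; apply pow2_abs).
    assert (Hdamp : 0 <= (m - 4 * ea) * p u ^ 2) by (apply Rmult_le_pos; [lra|apply pow2_ge_0]).
    assert (HQ : Q u = P ^ 2 / 2 + La * N ^ 2 / 2) by (unfold Q; rewrite HP2, HN2; reflexivity).
    assert (HAM : P * (D + P + N) <= (4 + / m) * (Q u + D ^ 2)).
    { assert (Y3 : P * (D + P + N) <= 2 * P ^ 2 + D ^ 2 / 2 + N ^ 2 / 2).
      { pose proof (pow2_ge_0 (P - D)). pose proof (pow2_ge_0 (P - N)). nra. }
      assert (Y4 : N ^ 2 / 2 <= / m * (La * N ^ 2 / 2)).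
      { apply Rle_trans with (/ m * (m * N ^ 2 / 2)); [right; field; lra|].
        apply Rmult_le_compat_l; [lra|]. pose proof (pow2_ge_0 N). nra. }
      pose proof (pow2_ge_0 P). pose proof (pow2_ge_0 D). pose proof (pow2_ge_0 N).
      assert (0 <= La * N ^ 2) by (apply Rmult_le_pos; lra).
      assert (0 <= / m * (P ^ 2 / 2)) by (apply Rmult_le_pos; lra).
      assert (0 <= / m * D ^ 2) by (apply Rmult_le_pos; lra).
      rewrite HQ. lra. }
    assert (G * A * (P * (D + P + N)) <= G * A * ((4 + / m) * (Q u + D ^ 2))).
    { apply Rmult_le_compat_l; [apply Rmult_le_pos; lra|exact HAM]. }
    unfold A2. lra. }
  (* Adding [D^2] makes the differential inequality homogeneous; [A2 * C / 2 * exp (2 t)] is a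
     primitive of its coefficient. *)
  assert (Hgron : forall s, s <= t -> Q t + D ^ 2 <= (Q s + D ^ 2) * E).
  { intros s Hs.
    assert (K : (Q t + D ^ 2) * exp (- (A2 * C / 2 * exp (2 * t)))
                <= (Q s + D ^ 2) * exp (- (A2 * C / 2 * exp (2 * s)))).
    { apply (derive_nonpos_le (fun u => (Q u + D ^ 2) * exp (- (A2 * C / 2 * exp (2 * u))))
        (fun u => exp (- (A2 * C / 2 * exp (2 * u))) *
            (p u * (dp u + La * d u) - A2 * (C * exp (2 * u)) * (Q u + D ^ 2)))); [exact Hs| |].
      - intros u _. der_sol HdQ Hdp. field.
      - intros u Hu. specialize (Hbnd u ltac:(lra)).
        pose proof (exp_pos (- (A2 * C / 2 * exp (2 * u)))). nra. }
    assert (HQs : forall u, 0 <= Q u + D ^ 2).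
    { intros u. unfold Q. pose proof (pow2_ge_0 (p u)). pose proof (pow2_ge_0 (d u)).
      pose proof (pow2_ge_0 D). nra. }
    pose proof (HQs t). pose proof (HQs s).
    assert (HAC : 0 < A2 * C / 2) by nra.
    assert (E1 : exp (- (A2 * C / 2 * exp (2 * s))) <= 1).
    { rewrite <- exp_0. apply exp_le. pose proof (exp_pos (2 * s)). nra. }
    assert (E2 : 1 <= exp (- (A2 * C / 2 * exp (2 * t))) * E).
    { unfold E. rewrite <- exp_plus, <- exp_0. apply exp_le.
      assert (exp (2 * t) <= exp (2 * T)) by (apply exp_le; lra). nra. }
    pose proof (exp_pos (- (A2 * C / 2 * exp (2 * s)))).
    apply Rle_trans with ((Q t + D ^ 2) * (exp (- (A2 * C / 2 * exp (2 * t))) * E)); [nra|].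
    rewrite <- Rmult_assoc. apply Rmult_le_compat_r; [lra|].
    apply Rle_trans with (1 := K). nra. }
  (* Since [Q s = O(exp (4 s))], letting [s -> -oo] removes the initial value. *)
  assert (HQt : Q t <= D ^ 2 * E).
  { apply le_epsilon. intros eps Heps.
    set (c := (2 + 4 * m) * C ^ 2 * E).
    assert (Hc : 0 < c).
    { unfold c. apply Rmult_lt_0_compat; [|lra]. apply Rmult_lt_0_compat; nra. }
    destruct (exp_small 4 (eps / c)) as [s0 Hs0]; [lra|apply Rdiv_lt_0_compat; lra|].
    set (s := Rmin t s0). assert (s <= t) by apply Rmin_l. assert (s <= s0) by apply Rmin_r.
    specialize (Hs0 s H0). specialize (Hgron s H).
    destruct (Ba s ltac:(lra)) as [Y1 Y2]. destruct (Bb s ltac:(lra)) as [Z1 Z2].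
    set (G := C * exp (2 * s)) in *.
    assert (HG2 : G ^ 2 = C ^ 2 * exp (4 * s)).
    { unfold G. replace (4 * s) with (2 * s + 2 * s) by ring. rewrite exp_plus. ring. }
    assert (Hps : p s ^ 2 <= 4 * G ^ 2).
    { rewrite <- pow2_abs. replace (4 * G ^ 2) with ((2 * G) ^ 2) by ring.
      apply pow_incr. split; [apply Rabs_pos|]. unfold p.
      apply Rle_trans with (1 := Rabs_triang _ _). rewrite Rabs_Ropp. lra. }
    assert (Hds : d s ^ 2 <= 4 * G ^ 2).
    { rewrite <- pow2_abs. replace (4 * G ^ 2) with ((2 * G) ^ 2) by ring.
      apply pow_incr. split; [apply Rabs_pos|]. unfold d.
      apply Rle_trans with (1 := Rabs_triang _ _). rewrite Rabs_Ropp. lra. }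
    assert (HQs : Q s <= (2 + 4 * m) * G ^ 2).
    { unfold Q. pose proof (pow2_ge_0 (d s)).
      assert (La * d s ^ 2 <= 2 * m * (4 * G ^ 2)) by (apply Rmult_le_compat; lra). lra. }
    assert (Q s * E <= eps).
    { apply Rle_trans with ((2 + 4 * m) * G ^ 2 * E); [apply Rmult_le_compat_r; lra|].
      rewrite HG2. replace ((2 + 4 * m) * (C ^ 2 * exp (4 * s)) * E) with (c * exp (4 * s))
        by (unfold c; ring).
      replace eps with (c * (eps / c)) by (field; lra). apply Rmult_le_compat_l; lra. }
    pose proof (pow2_ge_0 D). lra. }
  assert (Hsq : forall x k, x ^ 2 <= D ^ 2 * k -> 0 <= k -> Rabs x <= (1 + k) * D).
  { intros x k Hx Hk. apply Rabs_le. pose proof (pow2_ge_0 D).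
    assert (x ^ 2 <= ((1 + k) * D) ^ 2) by nra.
    assert (0 <= (1 + k) * D) by nra. nra. }
  assert (Hpt : Rabs (p t) <= (1 + 2 * E) * D).
  { apply Hsq; [|lra]. unfold Q in HQt. pose proof (pow2_ge_0 (d t)).
    assert (0 <= La * d t ^ 2) by (apply Rmult_le_pos; lra). lra. }
  assert (Hdt : Rabs (d t) <= (1 + 2 * E / m) * D).
  { apply Hsq; [|lra]. unfold Q in HQt. pose proof (pow2_ge_0 (p t)). pose proof (pow2_ge_0 (d t)).
    apply Rmult_le_reg_l with m; [lra|].
    replace (m * (D ^ 2 * (2 * E / m))) with (2 * (D ^ 2 * E)) by (field; lra). nra. }
  assert (HlnL : Rabs (ln La - ln Lb) <= 4 / m * D).
  { apply Rle_trans with (1 := ln_diff_bound La Lb m ltac:(lra) ltac:(lra) ltac:(lra)).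
    replace (La - Lb) with (- 4 * (ea - eb)) by (unfold La, Lb, L0; ring).
    rewrite Rabs_mult, Rabs_left by lra. fold D. right. field. lra. }
  assert (0 <= 2 * E * D) by (apply Rmult_le_pos; lra).
  assert (0 <= 2 * E / m * D) by (apply Rmult_le_pos; lra).
  assert (0 <= 4 / m * D) by (apply Rmult_le_pos; lra).
  split.
  - replace (wa t - wb t) with (d t + (ln La - ln Lb)) by (unfold d; ring).
    apply Rle_trans with (1 := Rabs_triang _ _). lra.
  - replace (Xa t - Xb t) with (- p t) by (unfold p; ring). rewrite Rabs_Ropp. lra.
Qed.

(** * Zeros of the slope *)

(* [X] starts positive at [-oo] and changes sign at each zero. *)
Inductive nth_zero (X : R -> R) : nat -> R -> Prop :=
| nth_zero_first t : X t = 0 -> (forall u, u < t -> 0 < X u) -> nth_zero X 1 t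
| nth_zero_next j s t : nth_zero X j s -> s < t -> X t = 0 ->
    (forall u, s < u < t -> 0 < (-1) ^ j * X u) -> nth_zero X (S j) t.

Lemma pow_m1_cases (j : nat) : (-1) ^ j = 1 \/ (-1) ^ j = -1.
Proof. induction j as [|j [H|H]]; simpl; [left; reflexivity|right|left]; rewrite H; ring. Qed.

Lemma nth_zero_pos (X : R -> R) (i : nat) (t : R) : nth_zero X i t -> (1 <= i)%nat.
Proof. intros H. destruct H; lia. Qed.

Lemma nth_zero_root (X : R -> R) (i : nat) (t : R) : nth_zero X i t -> X t = 0.
Proof. intros H. destruct H; assumption. Qed.

Lemma nth_zero_unique (X : R -> R) (i : nat) (t : R) :
  nth_zero X i t -> forall t', nth_zero X i t' -> t = t'.
Proof.
  induction 1 as [t Ht Hpos|j s t Hs IH Hst Ht Hsg]; intros t' H'; inversion H'; subst.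
  - destruct (Rtotal_order t t') as [K|[K|K]]; [|exact K|].
    + specialize (H0 t K). lra.
    + specialize (Hpos t' K). lra.
  - apply nth_zero_pos in H0. lia.
  - apply nth_zero_pos in Hs. lia.
  - apply IH in H0. subst s0.
    destruct (Rtotal_order t t') as [K|[K|K]]; [|exact K|].
    + specialize (H3 t ltac:(lra)). rewrite Ht in H3. lra.
    + specialize (Hsg t' ltac:(lra)). rewrite H2 in Hsg. lra.
Qed.

(** At a zero of [X] the equation reduces to [X' = exp (2 t) (exp w - 1)], which has the sign of
    [w]. *)
Lemma zero_crossing (m e : R) (w X : R -> R) (t s : R) :
  singular_sol m e w X -> X t = 0 -> s = 1 \/ s = -1 -> 0 < s * w t ->
  exists d, 0 < d /\ (forall u, t < u < t + d -> 0 < s * X u) /\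
    (forall u, t - d < u < t -> s * X u < 0).
Proof.
  intros [_ [HX _]] H0 Hs Hw. specialize (HX t). rewrite H0 in HX.
  pose proof (exp_pos (2 * t)).
  apply (derive_sign_right (fun u => s * X u) t
    (s * (e * 0 ^ 2 - m * 0 + exp (2 * t) * (exp (w t) - 1)))).
  - apply (is_derive_scal X t s), HX.
  - rewrite H0. ring.
  - destruct Hs; subst s.
    + assert (1 < exp (w t)) by (rewrite <- exp_0; apply exp_increasing; lra). nra.
    + assert (exp (w t) < 1) by (rewrite <- exp_0; apply exp_increasing; lra). nra.
Qed.

(** While [s * w > 0], [s * X] passes upwards through every zero of [X]. Having left zero upwards,
    it could only come back downwards. *)
Lemma sign_after_zero (m e : R) (w X : R -> R) (a b s : R) :
  singular_sol m e w X -> X a = 0 -> s = 1 \/ s = -1 ->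
  (forall t, a <= t <= b -> 0 < s * w t) ->
  forall t, a < t <= b -> 0 < s * X t.
Proof.
  intros Hsol H0 Hs Hw t Ht. apply Rnot_le_lt. intro Hle.
  destruct (zero_crossing m e w X a s Hsol H0 Hs) as [d [Hd [Hd1 _]]]; [apply Hw; lra|].
  set (c := Rmin (a + d / 2) t).
  assert (Hc : a < c <= t) by (unfold c, Rmin; destruct (Rle_dec (a + d / 2) t); lra).
  assert (Hc' : c <= a + d / 2) by apply Rmin_l.
  destruct (first_zero_signed X c t s Hs) as [z [Hz1 [Hz2 Hz3]]]; try lra.
  - intros u _. apply (sol_cont_X m e w X u Hsol).
  - apply Hd1. lra.
  - destruct (zero_crossing m e w X z s Hsol Hz2 Hs) as [d' [Hd' [_ Hd2]]]; [apply Hw; lra|].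
    set (v := Rmax c (z - d' / 2)).
    assert (Hv : c <= v < z) by (unfold v, Rmax; destruct (Rle_dec c (z - d' / 2)); lra).
    assert (Hv' : z - d' / 2 <= v) by apply Rmax_r.
    specialize (Hz3 v Hv). specialize (Hd2 v ltac:(lra)). lra.
Qed.

(** [X] arrives at its [i]-th zero with sign [(-1)^(i-1)], so it must leave with the opposite sign,
    which by the crossing rule is that of [w]. *)
Lemma nth_zero_sign (m e : R) (w X : R -> R) (i : nat) (t : R) :
  0 < m -> 0 < e -> singular_sol m e w X -> nth_zero X i t -> 0 < (-1) ^ i * w t.
Proof.
  intros Hm He Hsol H.
  pose proof (crit_w_nonzero m e w X t Hm He Hsol (nth_zero_root X i t H)) as Hne.
  destruct H as [t Ht Hpos|j s t Hs Hst Ht Hsg].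
  - pose proof (first_crit_w_neg m e w X t Hm He Hsol Ht Hpos). simpl. lra.
  - apply Rnot_le_lt. intro Hle. simpl in Hle.
    assert (Hw : 0 < (-1) ^ j * w t) by (destruct (pow_m1_cases j) as [E|E]; rewrite E in *; lra).
    destruct (zero_crossing m e w X t _ Hsol Ht (pow_m1_cases j) Hw) as [d [Hd [_ Hd2]]].
    set (v := Rmax ((s + t) / 2) (t - d / 2)).
    assert (Hv : s < v < t) by (unfold v, Rmax; destruct (Rle_dec ((s + t) / 2) (t - d / 2)); lra).
    assert (Hv' : t - d / 2 <= v) by apply Rmax_r.
    specialize (Hsg v Hv). specialize (Hd2 v ltac:(lra)). lra.
Qed.

Lemma next_zero (m e : R) (w X : R -> R) (i : nat) (t b : R) :
  0 < m -> 0 < e -> singular_sol m e w X -> nth_zero X i t -> t < b -> (-1) ^ i * X b <= 0 ->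
  exists t', t < t' <= b /\ nth_zero X (S i) t'.
Proof.
  intros Hm He Hsol H Htb Hb.
  pose proof (nth_zero_sign m e w X i t Hm He Hsol H) as Hw.
  destruct (zero_crossing m e w X t _ Hsol (nth_zero_root X i t H) (pow_m1_cases i) Hw)
    as [d [Hd [Hd1 _]]].
  set (c := Rmin (t + d / 2) b).
  assert (Hc : t < c <= b) by (unfold c, Rmin; destruct (Rle_dec (t + d / 2) b); lra).
  assert (Hc' : c <= t + d / 2) by apply Rmin_l.
  destruct (first_zero_signed X c b _ (pow_m1_cases i)) as [z [Hz1 [Hz2 Hz3]]]; try lra.
  - intros u _. apply (sol_cont_X m e w X u Hsol).
  - apply Hd1. lra.
  - exists z. split; [lra|]. apply (nth_zero_next X i t z H); [lra|exact Hz2|].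
    intros u Hu. destruct (Rlt_le_dec u c); [apply Hd1; lra|apply Hz3; lra].
Qed.

(* If [X] did not vanish after its [i]-th zero, [w] would be strictly monotone
   there and could not vanish in two disjoint Sturm windows. *)
Lemma nth_zero_exists (m e1 : R) : 0 < e1 -> 4 * e1 < m ->
  exists M : nat -> R, forall i, (1 <= i)%nat -> forall e w X,
    0 < e <= e1 -> singular_sol m e w X -> exists t, nth_zero X i t /\ t <= M i.
Proof.
  intros He1 Hm.
  destruct (first_crit_uniform m e1 He1 Hm) as [T0 [T1 [k [B [HT01 [Hk [HB Hfc]]]]]]].
  pose proof PI_RGT_0 as Hpi. pose proof PI_4 as Hpi4.
  set (q := exp (- ((1 + e1) * k))). assert (Hq : 0 < q) by apply exp_pos.
  destruct (exp_large 2 ((1 + m ^ 2 / 4) / q)) as [c1 Hc1]; [lra|].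
  set (T2 := Rmax T1 c1).
  assert (HT2 : T1 <= T2 /\ c1 <= T2) by (split; [apply Rmax_l|apply Rmax_r]).
  (* Each further zero costs two Sturm windows started [5] apart, which fit into [10] units of
     time. *)
  exists (fun i => T2 + 10 * INR i). intros i Hi e w X He Hsol.
  destruct (Hfc e w X He Hsol) as [_ [t1 [Ht1 [H0 [Hpos Hmid]]]]].
  pose proof (first_crit_w_neg m e w X t1 ltac:(lra) ltac:(lra) Hsol H0 Hpos) as Hneg.
  destruct (Hmid t1 ltac:(lra)) as [_ Hwt1].
  assert (Hwin : forall c, T2 <= c -> exists t, c <= t <= c + PI /\ w t = 0).
  { intros c Hc. apply (w_zero_window m e1 k c e w X He Hk Hsol).
    - intros t Ht. apply (tail_bounds m e k w X t1); try lra. exact Hsol.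
    - fold q. specialize (Hc1 c ltac:(lra)).
      apply Rmult_le_compat_r with (r := q) in Hc1; [|lra].
      replace ((1 + m ^ 2 / 4) / q * q) with (1 + m ^ 2 / 4) in Hc1 by (field; lra).
      exact Hc1. }
  induction i as [|i IH]; [lia|].
  destruct i as [|i].
  - exists t1. split; [apply nth_zero_first; assumption|]. simpl. lra.
  - destruct (IH ltac:(lia)) as [t [Ht Htm]]. set (j := S i) in *.
    assert (Hj : 0 <= INR j) by apply pos_INR.
    set (Mj := T2 + 10 * INR j) in *.
    assert (Hex : exists b, t < b <= Mj + 10 /\ (-1) ^ j * X b <= 0).
    { apply NNPP. intro Hno.
      destruct (Hwin Mj ltac:(unfold Mj; lra)) as [z1 [Hz1 Hz1']].
      destruct (Hwin (Mj + 5) ltac:(unfold Mj; lra)) as [z2 [Hz2 Hz2']].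
      assert ((-1) ^ j * w z2 < (-1) ^ j * w z1).
      { apply (derive_neg_lt (fun t => (-1) ^ j * w t) (fun t => (-1) ^ j * - X t)); [lra| |].
        - intros u _. apply (is_derive_scal w u), (proj1 Hsol).
        - intros u Hu. apply Rnot_le_lt. intro Hle. apply Hno. exists u. split; lra. }
      rewrite Hz1', Hz2' in H. lra. }
    destruct Hex as [b [Hb1 Hb2]].
    destruct (next_zero m e w X j t b ltac:(lra) ltac:(lra) Hsol Ht ltac:(lra) Hb2)
      as [t' [Ht'1 Ht'2]].
    exists t'. split; [exact Ht'2|]. rewrite S_INR. unfold Mj in Hb1. lra.
Qed.

Lemma continuous_pos_margin (f : R -> R) (a b : R) :
  (forall t, a <= t <= b -> continuous f t) -> (forall t, a <= t <= b -> 0 < f t) ->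
  exists c, 0 < c /\ forall t, a <= t <= b -> c <= f t.
Proof.
  intros Hc Hp. destruct (Rlt_le_dec b a) as [Hba|Hab].
  { exists 1. split; [lra|]. intros; lra. }
  destruct (continuity_ab_min f a b Hab) as [x [Hx1 Hx2]].
  - intros c Hcc. apply continuity_pt_filterlim, Hc, Hcc.
  - exists (f x). split; [apply Hp, Hx2|exact Hx1].
Qed.

Lemma signed_continuous (f : R -> R) (s t : R) : continuous f t -> continuous (fun u => s * f u) t.
Proof. intros H. apply (continuous_scal_r s f t), H. Qed.

(** On compact intervals free of zeros [X] has a margin, which the Lipschitz estimate passes on to
    nearby exponents; the half-line at [-oo] is covered by [start_unit]. Just after a zero there is
    no margin for [X], so the sign of [w] is passed on instead, and it forbids a spurious zero of
    [X']. *)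
Lemma nth_zero_stable (m e1 : R) : 0 < e1 -> 4 * e1 < m ->
  forall e w X i t, 0 < e <= e1 -> singular_sol m e w X -> nth_zero X i t ->
  forall d, 0 < d -> exists eta, 0 < eta /\
    forall e' w' X', 0 < e' <= e1 -> singular_sol m e' w' X' -> Rabs (e - e') < eta ->
      exists t', nth_zero X' i t' /\ Rabs (t' - t) < d.
Proof.
  intros He1 Hm e w X i t He Hsol H.
  assert (HcX : forall s u, continuous (fun v => s * X v) u).
  { intros s u. apply signed_continuous, (sol_cont_X m e w X u Hsol). }
  assert (Hcw : forall s u, continuous (fun v => s * w v) u).
  { intros s u. apply signed_continuous, (sol_cont_w m e w X u Hsol). }
  assert (Hclose : forall s a b (f : R -> R), s = 1 \/ s = -1 -> f = w \/ f = X ->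
    (forall u, a <= u <= b -> 0 < s * f u) ->
    exists eta, 0 < eta /\ forall e' w' X', 0 < e' <= e1 -> singular_sol m e' w' X' ->
      Rabs (e - e') < eta -> forall u, a <= u <= b -> 
      (f = w -> 0 < s * w' u) /\ (f = X -> 0 < s * X' u)).
  { intros s a b f Hs Hf Hp.
    destruct (continuous_pos_margin (fun u => s * f u) a b) as [c [Hc1 Hc2]].
    - intros u _. destruct Hf; subst f; [apply Hcw|apply HcX].
    - exact Hp.
    - destruct (sol_lipschitz m e1 b He1 Hm) as [K [HK HL]].
      exists (c / K). split; [apply Rdiv_lt_0_compat; lra|].
      intros e' w' X' He' Hsol' Hee u Hu.
      destruct (HL e e' w X w' X' He He' Hsol Hsol' u ltac:(lra)) as [L1 L2].
      assert (K * Rabs (e - e') < c).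
      { replace c with (K * (c / K)) by (field; lra). apply Rmult_lt_compat_l; lra. }
      specialize (Hc2 u Hu).
      split; intros E; subst f.
      + apply Rabs_le_between in L1. destruct Hs; subst s; lra.
      + apply Rabs_le_between in L2. destruct Hs; subst s; lra. }
  induction H as [t Ht Hpos|j s t Hs IH Hst Ht Hsg]; intros d Hd.
  - pose proof (first_crit_w_neg m e w X t ltac:(lra) ltac:(lra) Hsol Ht Hpos) as Hneg.
    destruct (zero_crossing m e w X t (-1) Hsol Ht ltac:(right; reflexivity) ltac:(lra))
      as [r [Hr [Hr1 Hr2]]].
    set (rho := Rmin (d / 2) (r / 2)).
    assert (Hrho : 0 < rho) by (apply Rmin_glb_lt; lra).
    assert (Hrd : rho <= d / 2) by apply Rmin_l. assert (Hrr : rho <= r / 2) by apply Rmin_r.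
    destruct (start_unit m e1 He1 Hm) as [T0 HT0].
    destruct (Hclose 1 T0 (t - rho) X) as [eta1 [He1p Heta1]];
      [left; reflexivity|right; reflexivity| |].
    { intros u Hu. rewrite Rmult_1_l. apply Hpos. lra. }
    destruct (Hclose (-1) (t + rho) (t + rho) X) as [eta2 [He2p Heta2]];
      [right; reflexivity|right; reflexivity| |].
    { intros u Hu. apply Hr1. lra. }
    exists (Rmin eta1 eta2). split; [apply Rmin_glb_lt; assumption|].
    intros e' w' X' He' Hsol' Hee.
    pose proof (Rmin_l eta1 eta2). pose proof (Rmin_r eta1 eta2).
    assert (Hpre : forall u, u <= t - rho -> 0 < X' u).
    { intros u Hu. destruct (Rle_lt_dec T0 u) as [Hle|Hlt].
      - destruct (Heta1 e' w' X' He' Hsol' ltac:(lra) u ltac:(lra)) as [_ K].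
        specialize (K eq_refl). lra.
      - destruct (HT0 e' w' X' He' Hsol' u ltac:(lra)) as [K _].
        apply Rabs_le_between in K. lra. }
    destruct (Heta2 e' w' X' He' Hsol' ltac:(lra) (t + rho) ltac:(lra)) as [_ K].
    specialize (K eq_refl).
    destruct (first_zero X' (t - rho) (t + rho)) as [z [Hz1 [Hz2 Hz3]]]; try lra.
    { intros u _. apply (sol_cont_X m e' w' X' u Hsol'). }
    { apply Hpre. lra. }
    exists z. split.
    + apply nth_zero_first; [exact Hz2|]. intros u Hu.
      destruct (Rle_lt_dec u (t - rho)); [apply Hpre; lra|apply Hz3; lra].
    + apply Rabs_def1; lra.
  - set (sg := (-1) ^ j) in *. pose proof (pow_m1_cases j : sg = 1 \/ sg = -1) as Hsgc.
    pose proof (nth_zero_sign m e w X j s ltac:(lra) ltac:(lra) Hsol Hs) as Hws. fold sg in Hws.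
    pose proof (nth_zero_sign m e w X (S j) t ltac:(lra) ltac:(lra) Hsol
      (nth_zero_next X j s t Hs Hst Ht Hsg)) as Hwt. simpl in Hwt. fold sg in Hwt.
    destruct (continuous_sign_near w s sg (sol_cont_w m e w X s Hsol) Hws) as [r1 [Hr1 Hr1']].
    set (rho1 := Rmin (r1 / 2) ((t - s) / 4)).
    assert (Hrho1 : 0 < rho1) by (apply Rmin_glb_lt; lra).
    assert (Hr1d : rho1 <= r1 / 2) by apply Rmin_l.
    assert (Hr1t : rho1 <= (t - s) / 4) by apply Rmin_r.
    destruct (zero_crossing m e w X t (- sg) Hsol Ht) as [r [Hr [Hrp Hrn]]].
    { destruct Hsgc as [E|E]; rewrite E; [right|left]; ring. }
    { lra. }
    set (rho2 := Rmin (Rmin (d / 2) (r / 2)) ((t - s) / 4)).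
    assert (Hrho2 : 0 < rho2) by (apply Rmin_glb_lt; [apply Rmin_glb_lt; lra|lra]).
    assert (Hr2 : rho2 <= Rmin (d / 2) (r / 2)) by apply Rmin_l.
    assert (Hr2t : rho2 <= (t - s) / 4) by apply Rmin_r.
    pose proof (Rmin_l (d / 2) (r / 2)). pose proof (Rmin_r (d / 2) (r / 2)).
    destruct (IH rho1 Hrho1) as [eta0 [He0p Heta0]].
    destruct (Hclose sg (s - rho1) (s + rho1) w Hsgc) as [eta1 [He1p Heta1]];
      [left; reflexivity| |].
    { intros u Hu. apply Hr1'. apply Rabs_def1; lra. }
    destruct (Hclose sg (s + rho1) (t - rho2) X Hsgc) as [eta2 [He2p Heta2]];
      [right; reflexivity| |].
    { intros u Hu. apply Hsg. lra. }
    destruct (Hclose (- sg) (t + rho2) (t + rho2) X) as [eta3 [He3p Heta3]].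
    { destruct Hsgc as [E|E]; rewrite E; [right|left]; ring. }
    { right; reflexivity. }
    { intros u Hu. apply Hrp. lra. }
    exists (Rmin (Rmin eta0 eta1) (Rmin eta2 eta3)).
    split; [apply Rmin_glb_lt; apply Rmin_glb_lt; assumption|].
    intros e' w' X' He' Hsol' Hee.
    pose proof (Rmin_l (Rmin eta0 eta1) (Rmin eta2 eta3)).
    pose proof (Rmin_r (Rmin eta0 eta1) (Rmin eta2 eta3)).
    pose proof (Rmin_l eta0 eta1). pose proof (Rmin_r eta0 eta1).
    pose proof (Rmin_l eta2 eta3). pose proof (Rmin_r eta2 eta3).
    destruct (Heta0 e' w' X' He' Hsol' ltac:(lra)) as [s' [Hs' Hss]].
    apply Rabs_def2 in Hss.
    assert (A1 : forall u, s' < u <= s + rho1 -> 0 < sg * X' u).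
    { apply (sign_after_zero m e' w' X' s' (s + rho1) sg Hsol' (nth_zero_root X' j s' Hs') Hsgc).
      intros u Hu. apply (Heta1 e' w' X' He' Hsol' ltac:(lra) u ltac:(lra)). reflexivity. }
    assert (A2 : forall u, s + rho1 <= u <= t - rho2 -> 0 < sg * X' u).
    { intros u Hu. apply (Heta2 e' w' X' He' Hsol' ltac:(lra) u Hu). reflexivity. }
    assert (A3 : 0 < - sg * X' (t + rho2)).
    { apply (Heta3 e' w' X' He' Hsol' ltac:(lra) (t + rho2) ltac:(lra)). reflexivity. }
    destruct (first_zero_signed X' (t - rho2) (t + rho2) sg Hsgc) as [z [Hz1 [Hz2 Hz3]]]; try lra.
    { intros u _. apply (sol_cont_X m e' w' X' u Hsol'). }
    { apply A2. lra. }
    exists z. split.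
    + apply (nth_zero_next X' j s' z Hs'); [lra|exact Hz2|].
      intros u Hu. fold sg.
      destruct (Rle_lt_dec u (s + rho1)) as [C1|C1]; [apply A1; lra|].
      destruct (Rle_lt_dec u (t - rho2)) as [C2|C2]; [apply A2; lra|apply Hz3; lra].
    + apply Rabs_def1; lra.
Qed.

(** * Reaching the prescribed radius *)

Lemma nth_zero_hits (m et lr : R) (i : nat) (wf Xf : R -> R -> R) :
  0 < et -> 4 * et < m -> (1 <= i)%nat ->
  (forall e, 0 < e -> 4 * e < m -> singular_sol m e (wf e) (Xf e)) ->
  (forall t, nth_zero (Xf et) i t -> lr < t + ln et / 2) ->
  exists e, 0 < e <= et /\ nth_zero (Xf e) i (lr - ln e / 2).
Proof.
  intros Het Hm Hi Hsol Hup.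
  (* Strictly between [et] and [m / 4], so that [tau] is continuous at the endpoint [et] as well. *)
  set (e1 := (et + m / 4) / 2).
  assert (He1 : et < e1 /\ 4 * e1 < m) by (unfold e1; lra). destruct He1 as [He1 He1m].
  destruct (nth_zero_exists m e1 ltac:(lra) He1m) as [M HM].
  set (tau := fun e => epsilon (inhabits 0) (fun t => nth_zero (Xf e) i t)).
  assert (Htau : forall e, 0 < e <= e1 -> nth_zero (Xf e) i (tau e) /\ tau e <= M i).
  { intros e He. destruct (HM i Hi e (wf e) (Xf e) He (Hsol e ltac:(lra) ltac:(lra)))
      as [t [Ht1 Ht2]].
    assert (K : nth_zero (Xf e) i (tau e)).
    { apply (epsilon_spec (inhabits 0) (fun t => nth_zero (Xf e) i t)). exists t. exact Ht1. }
    split; [exact K|]. rewrite (nth_zero_unique _ _ _ K t Ht1). exact Ht2. }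
  assert (Hcont : forall e, 0 < e < e1 -> continuity_pt tau e).
  { intros e He eps Heps.
    destruct (nth_zero_stable m e1 ltac:(lra) He1m e (wf e) (Xf e) i (tau e) ltac:(lra)
      (Hsol e ltac:(lra) ltac:(lra)) (proj1 (Htau e ltac:(lra))) eps Heps) as [eta [Heta Hst]].
    exists (Rmin eta (Rmin e (e1 - e))). split.
    { apply Rmin_glb_lt; [lra|apply Rmin_glb_lt; lra]. }
    intros x [_ Hx].
    change (Rabs (x - e) < Rmin eta (Rmin e (e1 - e))) in Hx.
    change (Rabs (tau x - tau e) < eps).
    pose proof (Rmin_l eta (Rmin e (e1 - e))). pose proof (Rmin_r eta (Rmin e (e1 - e))).
    pose proof (Rmin_l e (e1 - e)). pose proof (Rmin_r e (e1 - e)).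
    assert (Hxe : Rabs (e - x) < eta) by (rewrite Rabs_minus_sym; lra).
    apply Rabs_def2 in Hx.
    destruct (Hst x (wf x) (Xf x) ltac:(lra) (Hsol x ltac:(lra) ltac:(lra)) Hxe) as [t' [Ht'1 Ht'2]].
    rewrite (nth_zero_unique _ _ _ (proj1 (Htau x ltac:(lra))) t' Ht'1). exact Ht'2. }
  (* Since [tau ea <= M i] with [M i] independent of [e], this gives
     [tau ea + ln ea / 2 <= lr - 1]. *)
  set (ea := Rmin (et / 2) (exp (2 * (lr - M i - 1)))).
  pose proof (exp_pos (2 * (lr - M i - 1))) as Hexp.
  assert (Hea : 0 < ea) by (apply Rmin_glb_lt; lra).
  assert (Hea1 : ea <= et / 2) by apply Rmin_l.
  assert (Hlea : ln ea <= 2 * (lr - M i - 1)).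
  { rewrite <- (ln_exp (2 * (lr - M i - 1))). apply ln_le; [exact Hea|apply Rmin_r]. }
  destruct (Ranalysis5.IVT_interv (fun e => tau e + ln e / 2 - lr) ea et) as [z [Hz1 Hz2]].
  - intros a Ha. apply continuity_pt_minus; [apply continuity_pt_plus|].
    + apply Hcont. lra.
    + apply continuity_pt_filterlim,
        (ex_derive_continuous (V := R_NormedModule) (fun e => ln e / 2)).
      auto_derive. lra.
    + apply continuity_pt_const. intros x y. reflexivity.
  - lra.
  - destruct (Htau ea ltac:(lra)) as [_ K]. lra.
  - specialize (Hup (tau et) (proj1 (Htau et ltac:(lra)))). lra.
  - exists z. split; [lra|]. replace (lr - ln z / 2) with (tau z) by lra.
    apply Htau. lra.
Qed.

(** * Counting the zeros of [X] and of [w] *)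

Lemma nth_zero_list (X : R -> R) (i : nat) (t : R) : nth_zero X i t ->
  exists l, NoDup l /\ length l = (i - 1)%nat /\ forall u, In u l <-> (X u = 0 /\ u < t).
Proof.
  induction 1 as [t Ht Hpos|j s t Hs IH Hst Ht Hsg].
  - exists nil. split; [constructor|]. split; [reflexivity|].
    intros u. split; [intros []|]. intros [H1 H2]. specialize (Hpos u H2). lra.
  - destruct IH as [l [Hl1 [Hl2 Hl3]]]. pose proof (nth_zero_pos X j s Hs).
    exists (s :: l). split; [|split].
    + constructor; [|exact Hl1]. intro Hin. apply Hl3 in Hin. lra.
    + simpl. lia.
    + intros u. split.
      * intros [E|Hin]; [subst u; split; [apply (nth_zero_root X j s Hs)|exact Hst]|].
        apply Hl3 in Hin. lra.
      * intros [H1 H2]. destruct (Rtotal_order u s) as [K|[K|K]].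
        -- right. apply Hl3. split; assumption.
        -- left. symmetry. exact K.
        -- specialize (Hsg u ltac:(lra)). rewrite H1 in Hsg. lra.
Qed.

Lemma w_zero_unique_between (m e : R) (w X : R -> R) (a b s : R) :
  singular_sol m e w X -> s = 1 \/ s = -1 -> a < b ->
  (forall u, a < u < b -> 0 < s * X u) -> 0 < s * w a -> s * w b < 0 ->
  exists z, a < z < b /\ w z = 0 /\ forall u, a <= u <= b -> w u = 0 -> u = z.
Proof.
  intros Hsol Hs Hab HX Ha Hb.
  destruct (first_zero_signed w a b s Hs) as [z [Hz1 [Hz2 Hz3]]]; try lra.
  { intros u _. apply (sol_cont_w m e w X u Hsol). }
  assert (Hdec : forall u v, a <= u -> u < v -> v <= b -> s * w v < s * w u).
  { intros u v Hu Huv Hv. apply (derive_neg_lt (fun t => s * w t) (fun t => s * - X t)); [lra| |].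
    - intros x _. apply (is_derive_scal w x), (proj1 Hsol).
    - intros x Hx. specialize (HX x ltac:(lra)). lra. }
  exists z. split; [|split; [exact Hz2|]].
  - split; [lra|]. destruct (Rle_lt_or_eq_dec z b ltac:(lra)) as [K|K]; [exact K|].
    subst z. rewrite Hz2 in Hb. lra.
  - intros u Hu Hu0. destruct (Rtotal_order u z) as [K|[K|K]]; [|exact K|].
    + specialize (Hdec u z ltac:(lra) K ltac:(lra)). rewrite Hu0, Hz2 in Hdec. lra.
    + specialize (Hdec z u ltac:(lra) K ltac:(lra)). rewrite Hu0, Hz2 in Hdec. lra.
Qed.

(** [w] vanishes once between consecutive zeros of [X], never at them, and once more before the
    first, where it falls from [+oo] to a negative value. Hence [i] zeros, against [i - 1] zeros of
    [X] before [t]. *)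
Lemma w_zero_list (m e : R) (w X : R -> R) (i : nat) (t : R) :
  0 < m -> 0 < e -> singular_sol m e w X -> nth_zero X i t ->
  exists l, NoDup l /\ length l = i /\ forall u, In u l <-> (w u = 0 /\ u <= t).
Proof.
  intros Hm He Hsol.
  induction 1 as [t Ht Hpos|j s t Hs IH Hst Ht Hsg].
  - pose proof (first_crit_w_neg m e w X t Hm He Hsol Ht Hpos) as Hneg.
    assert (Hbig : exists T, forall a, a <= T -> 0 < w a).
    { destruct (proj2 (proj2 Hsol) 1 ltac:(lra)) as [T HT].
      exists (Rmin T ((ln (L0 m e) - 2) / 2)). intros a Ha.
      pose proof (Rmin_l T ((ln (L0 m e) - 2) / 2)). pose proof (Rmin_r T ((ln (L0 m e) - 2) / 2)).
      specialize (HT a ltac:(lra)). apply Rabs_def2 in HT. lra. }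
    destruct Hbig as [T HT].
    set (a := Rmin T (t - 1)).
    pose proof (Rmin_l T (t - 1)) as Ha1. pose proof (Rmin_r T (t - 1)) as Ha2. fold a in Ha1, Ha2.
    destruct (w_zero_unique_between m e w X a t 1 Hsol) as [z [Hz1 [Hz2 Hz3]]]; try lra.
    + intros u Hu. rewrite Rmult_1_l. apply Hpos. lra.
    + rewrite Rmult_1_l. apply HT. lra.
    + exists (z :: nil). split; [constructor; [intros []|constructor]|]. split; [reflexivity|].
      intros u. split.
      * intros [E|[]]. subst u. split; [exact Hz2|lra].
      * intros [H1 H2]. left. symmetry. apply Hz3; [|exact H1]. split; [|exact H2].
        apply Rnot_lt_le. intro K. specialize (HT u ltac:(lra)). lra.
  - destruct IH as [l [Hl1 [Hl2 Hl3]]].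
    pose proof (nth_zero_sign m e w X j s Hm He Hsol Hs) as Hws.
    pose proof (nth_zero_sign m e w X (S j) t Hm He Hsol (nth_zero_next X j s t Hs Hst Ht Hsg)) as Hwt.
    simpl in Hwt.
    destruct (w_zero_unique_between m e w X s t _ Hsol (pow_m1_cases j) Hst Hsg Hws ltac:(lra))
      as [z [Hz1 [Hz2 Hz3]]].
    exists (z :: l). split; [|split].
    + constructor; [|exact Hl1]. intro Hin. apply Hl3 in Hin. lra.
    + simpl. congruence.
    + intros u. split.
      * intros [E|Hin]; [subst u; split; [exact Hz2|lra]|]. apply Hl3 in Hin. lra.
      * intros [H1 H2]. destruct (Rle_lt_dec u s) as [K|K].
        -- right. apply Hl3. split; assumption.
        -- left. symmetry. apply Hz3; [lra|exact H1].
Qed.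

(** * Back to the radial equation *)

(* [sqrt e * exp t]. *)
Definition log_radius (e t : R) : R := exp (t + ln e / 2).

Definition log_sol (e : R) (u : R -> R) (t : R) : R := ln (u (log_radius e t)) / e.

(** The derivative of [- log_sol e u], written out so that its zeros are visibly those of
    [Derive u]. *)
Definition log_slope (e : R) (u : R -> R) (t : R) : R :=
  - (log_radius e t * Derive u (log_radius e t) / u (log_radius e t)) / e.

Lemma log_radius_sq (e t : R) : 0 < e -> log_radius e t * log_radius e t = e * exp (2 * t).
Proof.
  intros He. unfold log_radius. rewrite <- exp_plus.
  replace (t + ln e / 2 + (t + ln e / 2)) with (ln e + 2 * t) by field.
  rewrite exp_plus, exp_ln by exact He. reflexivity.
Qed.

Lemma log_radius_surj (e x : R) : 0 < x -> log_radius e (ln x - ln e / 2) = x.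
Proof.
  intros Hx. unfold log_radius. replace (ln x - ln e / 2 + ln e / 2) with (ln x) by ring.
  apply exp_ln, Hx.
Qed.

Lemma log_radius_inj (e : R) : Injective (log_radius e).
Proof. intros x y H. apply exp_inv in H. lra. Qed.

(** For [p = 1 + / e] one has [u^p = u * exp w], and [r^2 / e = exp (2 * t)]: the [/ e] created by
    the logarithm is cancelled by the factor [sqrt e] in the radius. *)
Lemma solves_star_singular (N : nat) (e : R) (u : R -> R) :
  0 < e -> 4 * e < INR N - 2 -> solves_star N (1 + / e) u ->
  singular_sol (INR N - 2) e (log_sol e u) (log_slope e u).
Proof.
  intros He Hm [Hode Hlim].
  set (v := Derive u) in *. set (v2 := Derive v) in *.
  assert (Hu : forall r, 0 < r -> is_derive u r (v r) /\ is_derive v r (v2 r) /\ 0 < u r /\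
     v2 r = - (INR N - 1) / r * v r + u r - Rpower (u r) (1 + / e)).
  { intros r Hr. destruct (Hode r Hr) as [H1 [H2 [H3 H4]]].
    split; [apply Derive_correct, H1|]. split; [apply Derive_correct, H2|].
    split; [exact H3|]. replace (- (INR N - 1) / r) with (- ((INR N - 1) / r)) by (field; lra).
    lra. }
  assert (Hrad : forall t, is_derive (log_radius e) t (log_radius e t)).
  { intros t. unfold log_radius. auto_derive; [exact I|ring]. }
  assert (Hrp : forall t, 0 < log_radius e t) by (intros t; apply exp_pos).
  assert (Huc : forall t, is_derive (fun t => u (log_radius e t)) t
                 (log_radius e t * v (log_radius e t))).
  { intros t. apply (is_derive_comp u (log_radius e)); [apply Hu, Hrp|apply Hrad]. }
  assert (Hvc : forall t, is_derive (fun t => v (log_radius e t)) t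
                 (log_radius e t * v2 (log_radius e t))).
  { intros t. apply (is_derive_comp v (log_radius e)); [apply Hu, Hrp|apply Hrad]. }
  split; [|split].
  - intros t. unfold log_sol, log_slope. fold v.
    pose proof (proj1 (proj2 (proj2 (Hu _ (Hrp t))))) as Hpos.
    set (U := fun t => u (log_radius e t)) in *.
    assert (E : Derive (fun x => U x) t = log_radius e t * v (log_radius e t))
      by (apply is_derive_unique, Huc).
    change (is_derive (fun t => ln (U t) / e) t
      (- (- (log_radius e t * v (log_radius e t) / U t) / e))).
    change (0 < U t) in Hpos.
    auto_derive.
    + split; [eexists; apply Huc|]. split; [exact Hpos|exact I].
    + rewrite E. field. lra.
  - intros t. unfold log_slope. fold v.
    destruct (Hu _ (Hrp t)) as [_ [_ [Hpos Heq]]].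
    assert (Hpow : Rpower (u (log_radius e t)) (1 + / e) =
                   u (log_radius e t) * exp (log_sol e u t)).
    { unfold Rpower, log_sol.
      replace ((1 + / e) * ln (u (log_radius e t)))
        with (ln (u (log_radius e t)) + ln (u (log_radius e t)) / e) by (field; lra).
      rewrite exp_plus, exp_ln by exact Hpos. reflexivity. }
    rewrite Hpow in Heq. clear Hpow.
    pose proof (log_radius_sq e t He) as Hsq. pose proof (Hrp t) as Hr.
    set (g := exp (log_sol e u t)) in *.
    assert (Es : exp (2 * t) = log_radius e t * log_radius e t / e) by (rewrite Hsq; field; lra).
    rewrite Es. clear Es Hsq.
    set (U := fun t => u (log_radius e t)) in *. set (V := fun t => v (log_radius e t)) in *.
    change (u (log_radius e t)) with (U t) in *.
    change (v (log_radius e t)) with (V t) in *.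
    change (is_derive (fun t => - (log_radius e t * V t / U t) / e) t
       (e * (- (log_radius e t * V t / U t) / e) ^ 2 -
        (INR N - 2) * (- (log_radius e t * V t / U t) / e) +
        log_radius e t * log_radius e t / e * (g - 1))).
    assert (E1 : Derive (fun x => U x) t = log_radius e t * V t)
      by (apply is_derive_unique, Huc).
    assert (E2 : Derive (fun x => V x) t = log_radius e t * v2 (log_radius e t))
      by (apply is_derive_unique, Hvc).
    assert (E3 : Derive (fun x => log_radius e x) t = log_radius e t)
      by (apply is_derive_unique, Hrad).
    auto_derive.
    + repeat split.
      * eexists; apply Hrad.
      * eexists; apply Hvc.
      * eexists; apply Huc.
      * lra.
    + rewrite E1, E2, E3, Heq. field. lra.
  - intros d Hd.
    set (A := A_pN (1 + / e) N) in *.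
    assert (Hth : theta (1 + / e) = 2 * e) by (unfold theta; field; lra).
    (* This [ln e] matches the one that [r^theta] produces through [r = sqrt e * exp t], so none
       survives in the limit of [w + 2 t]. *)
    assert (HA : ln A = e * (ln e + ln (L0 (INR N - 2) e))).
    { unfold A, A_pN, Rpower. rewrite ln_exp, Hth.
      replace (2 * e * (INR N - 2 - 2 * e)) with (e * L0 (INR N - 2) e) by (unfold L0; ring).
      rewrite ln_mult by (unfold L0; lra). field. lra. }
    assert (HAp : 0 < A) by (unfold A, A_pN, Rpower; apply exp_pos).
    assert (Hln : filterlim (fun r => ln (Rpower r (theta (1 + / e)) * u r)) (at_right 0)
                    (locally (ln A))).
    { apply (filterlim_comp _ _ _ _ ln _ _ _ Hlim).
      apply (ex_derive_continuous (V := R_NormedModule) ln A).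
      auto_derive. exact HAp. }
    assert (Hde : 0 < e * d) by (apply Rmult_lt_0_compat; lra).
    destruct (proj1 (filterlim_locally _ _) Hln (mkposreal _ Hde)) as [del Hdel].
    pose proof (cond_pos del) as Hdp.
    exists (ln del - ln e / 2 - 1). intros t Ht.
    assert (Hrd : log_radius e t < del).
    { unfold log_radius. rewrite <- (exp_ln del) by exact Hdp. apply exp_increasing. lra. }
    assert (Hb : ball 0 del (log_radius e t)).
    { change (Rabs (log_radius e t - 0) < del). rewrite Rminus_0_r.
      rewrite Rabs_right by (left; apply Hrp). exact Hrd. }
    specialize (Hdel _ Hb (Hrp t)).
    change (Rabs (ln (Rpower (log_radius e t) (theta (1 + / e)) * u (log_radius e t)) - ln A)
            < e * d) in Hdel.
    destruct (Hu _ (Hrp t)) as [_ [_ [Hpos _]]].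
    rewrite ln_mult, HA, Hth in Hdel; [|unfold Rpower; apply exp_pos|exact Hpos].
    unfold Rpower in Hdel. rewrite ln_exp in Hdel.
    unfold log_radius at 1 in Hdel. rewrite ln_exp in Hdel.
    replace (2 * e * (t + ln e / 2) + ln (u (log_radius e t)) -
       e * (ln e + ln (L0 (INR N - 2) e)))
      with (e * (log_sol e u t + 2 * t - ln (L0 (INR N - 2) e))) in Hdel
      by (unfold log_sol; field; lra).
    rewrite Rabs_mult, (Rabs_right e) in Hdel by lra.
    apply Rmult_lt_reg_l in Hdel; assumption.
Qed.

Lemma log_slope_zero (e : R) (u : R -> R) (t : R) :
  0 < e -> 0 < u (log_radius e t) ->
  (log_slope e u t = 0 <-> Derive u (log_radius e t) = 0).
Proof.
  intros He Hu. pose proof (exp_pos (t + ln e / 2) : 0 < log_radius e t) as Hr.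
  unfold log_slope. split; intro H.
  - replace (Derive u (log_radius e t)) with
      (- (- (log_radius e t * Derive u (log_radius e t) / u (log_radius e t)) / e)
        * (e * u (log_radius e t) / log_radius e t)) by (field; lra).
    rewrite H. ring.
  - rewrite H. field. lra.
Qed.

Lemma log_sol_zero (e : R) (u : R -> R) (t : R) :
  0 < e -> 0 < u (log_radius e t) -> (log_sol e u t = 0 <-> u (log_radius e t) = 1).
Proof.
  intros He Hu. unfold log_sol. split; intro H.
  - apply ln_inv; [exact Hu|lra|]. rewrite ln_1.
    replace (ln (u (log_radius e t))) with (ln (u (log_radius e t)) / e * e) by (field; lra).
    rewrite H. ring.
  - rewrite H, ln_1. field. lra.
Qed.

Lemma log_radius_list (e : R) (P Q : R -> Prop) (l : list R) :
  NoDup l -> (forall s, In s l <-> P s) ->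
  (forall r, Q r <-> 0 < r /\ P (ln r - ln e / 2)) ->
  exists l', NoDup l' /\ length l' = length l /\ forall r, In r l' <-> Q r.
Proof.
  intros Hnd Hl HQ. exists (map (log_radius e) l).
  split; [apply Injective_map_NoDup; [apply log_radius_inj|exact Hnd]|].
  split; [apply length_map|].
  intros r. rewrite in_map_iff, HQ. split.
  - intros [s [Hs1 Hs2]]. subst r. split; [apply exp_pos|].
    unfold log_radius. rewrite ln_exp. replace (s + ln e / 2 - ln e / 2) with s by ring.
    apply Hl, Hs2.
  - intros [H1 H2]. exists (ln r - ln e / 2). split; [apply log_radius_surj, H1|].
    apply Hl, H2.
Qed.

Lemma log_radius_lt (e r t : R) : 0 < r -> (r < log_radius e t <-> ln r - ln e / 2 < t).
Proof.
  intros Hr. unfold log_radius. split; intro H.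
  - apply ln_increasing in H; [|exact Hr]. rewrite ln_exp in H. lra.
  - rewrite <- (exp_ln r) by exact Hr. apply exp_increasing. lra.
Qed.

Lemma nth_zero_nth_crit (e : R) (u : R -> R) (i : nat) (t : R) :
  0 < e -> (forall r, 0 < r -> 0 < u r) ->
  nth_zero (log_slope e u) i t -> nth_crit u i (log_radius e t).
Proof.
  intros He Hu H. split; [apply (nth_zero_pos _ _ _ H)|].
  assert (Hz : forall r, 0 < r -> (log_slope e u (ln r - ln e / 2) = 0 <-> Derive u r = 0)).
  { intros r Hr. rewrite <- (log_radius_surj e r Hr) at 2.
    apply log_slope_zero; [exact He|apply Hu, exp_pos]. }
  split.
  - split; [apply exp_pos|]. apply (log_slope_zero e u t He); [apply Hu, exp_pos|].
    apply (nth_zero_root _ _ _ H).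
  - destruct (nth_zero_list _ _ _ H) as [l [Hl1 [Hl2 Hl3]]].
    destruct (log_radius_list e _ (fun x => crit_pt u x /\ x < log_radius e t) l Hl1 Hl3)
      as [l' [H1 [H2 H3]]].
    + intros r. unfold crit_pt. split.
      * intros [[K1 K2] K3]. split; [exact K1|]. split; [apply Hz; assumption|].
        apply log_radius_lt; assumption.
      * intros [K1 [K2 K3]]. split; [split; [exact K1|apply Hz; assumption]|].
        apply log_radius_lt; assumption.
    + exists l'. split; [exact H1|]. split; [congruence|exact H3].
Qed.

(** If [r' < r], then [r'] and the [i - 1] critical points below it all lie below [r], where there
    are only [j - 1 < i]. *)
Lemma nth_crit_le (u : R -> R) (i j : nat) (r r' : R) :
  (j <= i)%nat -> nth_crit u j r -> nth_crit u i r' -> r <= r'.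
Proof.
  intros Hij [Hj [_ [l [Hl1 [Hl2 Hl3]]]]] [Hi [Hc' [l' [Hl1' [Hl2' Hl3']]]]].
  apply Rnot_lt_le. intro Hlt.
  assert (K : (length (r' :: l') <= length l)%nat).
  { apply NoDup_incl_length.
    - constructor; [|exact Hl1']. intro Hin. apply Hl3' in Hin. lra.
    - intros x [E|Hx]; apply Hl3; [subst x; split; assumption|].
      apply Hl3' in Hx. destruct Hx as [Hx1 Hx2]. split; [exact Hx1|lra]. }
  simpl in K. lia.
Qed.

Lemma pS_lt_iff (N : nat) (e : R) : (3 <= N)%nat -> 0 < e ->
  (pS N < 1 + / e <-> 4 * e < INR N - 2).
Proof.
  intros HN He. assert (HN' : 3 <= INR N) by (apply le_INR in HN; simpl in HN; lra).
  assert (E : 1 + / e - pS N = (INR N - 2 - 4 * e) / (e * (INR N - 2))).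
  { unfold pS. field. lra. }
  assert (Hd : 0 < e * (INR N - 2)) by (apply Rmult_lt_0_compat; lra).
  split; intro H.
  - assert (Hp : 0 < (INR N - 2 - 4 * e) / (e * (INR N - 2)) * (e * (INR N - 2)))
      by (apply Rmult_lt_0_compat; lra).
    replace ((INR N - 2 - 4 * e) / (e * (INR N - 2)) * (e * (INR N - 2)))
      with (INR N - 2 - 4 * e) in Hp by (field; lra). lra.
  - assert (0 < (INR N - 2 - 4 * e) / (e * (INR N - 2))) by (apply Rdiv_lt_0_compat; lra). lra.
Qed.

Theorem theorem1p4 (N : nat) (Rad : R) (pt : R) (U : R -> R -> R) :
  (3 <= N)%nat ->
  0 < Rad ->
  pS N < pt ->
  (* U p is the (Miyamoto-unique) solution U_p^* of ( * )_p *)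
  (forall p, pS N < p -> solves_star N p (U p)) ->
  forall i : nat,
    (* i >= i*, where i* is the least index with R^{i*}_{pt} > Rad *)
    (exists j r, (j <= i)%nat /\ nth_crit (U pt) j r /\ Rad < r) ->
    exists p, pS N < p /\
      nth_crit (U p) i Rad /\
      (* the singular radial solution on B_Rad takes the value 1 exactly i times *)
      (exists l : list R, NoDup l /\ length l = i /\
         forall r, In r l <-> (0 < r <= Rad /\ U p r = 1)).
Proof.
  intros HN HR Hpt HU i [j [r [Hji [Hcr HRr]]]].
  assert (HN' : 3 <= INR N) by (apply le_INR in HN; simpl in HN; lra).
  assert (HpS : 1 < pS N).
  { unfold pS. apply Rmult_lt_reg_r with (INR N - 2); [lra|].
    replace ((INR N + 2) / (INR N - 2) * (INR N - 2)) with (INR N + 2) by (field; lra). lra. }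
  set (et := / (pt - 1)).
  assert (Het : 0 < et) by (apply Rinv_0_lt_compat; lra).
  assert (Hept : 1 + / et = pt) by (unfold et; rewrite Rinv_inv; ring).
  assert (Hpos : forall e, 0 < e -> 4 * e < INR N - 2 -> forall x, 0 < x -> 0 < U (1 + / e) x).
  { intros e He Hm x Hx. apply (HU (1 + / e)); [apply pS_lt_iff; assumption|exact Hx]. }
  assert (Hetm : 4 * et < INR N - 2) by (apply pS_lt_iff; [exact HN|exact Het|lra]).
  set (wf := fun e => log_sol e (U (1 + / e))).
  set (Xf := fun e => log_slope e (U (1 + / e))).
  assert (Hsol : forall e, 0 < e -> 4 * e < INR N - 2 -> singular_sol (INR N - 2) e (wf e) (Xf e)).
  { intros e He Hm. apply solves_star_singular; [exact He|exact Hm|].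
    apply HU, pS_lt_iff; assumption. }
  destruct (nth_zero_hits (INR N - 2) et (ln Rad) i wf Xf Het Hetm) as [e [He Hz]].
  - destruct Hcr as [Hj _]. lia.
  - exact Hsol.
  (* The [i]-th critical radius at [pt] is at least the [j]-th, hence beyond [Rad]: this is the
     upper end for the intermediate value theorem. *)
  - intros t Ht.
    pose proof (nth_zero_nth_crit et _ i t Het (Hpos et Het Hetm) Ht) as Hc.
    rewrite Hept in Hc. pose proof (nth_crit_le _ _ _ _ _ Hji Hcr Hc) as Hle.
    assert (Rad < log_radius et t) as Hlt by lra.
    apply log_radius_lt in Hlt; lra.
  - assert (Hem : 4 * e < INR N - 2) by lra.
    assert (Hsp : pS N < 1 + / e) by (apply pS_lt_iff; [exact HN|lra|exact Hem]).
    exists (1 + / e). split; [exact Hsp|].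
    pose proof (Hpos e ltac:(lra) Hem) as Hup. split.
    + pose proof (nth_zero_nth_crit e _ i _ ltac:(lra) Hup Hz) as Hc.
      rewrite log_radius_surj in Hc by exact HR. exact Hc.
    + destruct (w_zero_list (INR N - 2) e (wf e) (Xf e) i _ ltac:(lra) ltac:(lra)
        (Hsol e ltac:(lra) Hem) Hz) as [l [Hl1 [Hl2 Hl3]]].
      destruct (log_radius_list e _ (fun r => 0 < r <= Rad /\ U (1 + / e) r = 1) l Hl1 Hl3)
        as [l' [H1 [H2 H3]]].
      * intros x.
        assert (Hx : 0 < x -> (wf e (ln x - ln e / 2) = 0 <-> U (1 + / e) x = 1)).
        { intros Hx. rewrite <- (log_radius_surj e x Hx) at 2.
          apply log_sol_zero; [lra|apply Hup, exp_pos]. }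
        split.
        -- intros [[K1 K2] K3]. split; [exact K1|]. split; [apply Hx; assumption|].
           pose proof (ln_le x Rad K1 K2). lra.
        -- intros [K1 [K2 K3]]. split; [|apply Hx; assumption]. split; [exact K1|].
           apply Rnot_lt_le. intro K. apply ln_increasing in K; [lra|exact HR].
      * exists l'. split; [exact H1|]. split; [congruence|exact H3].
Qed.
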